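(* Let $\alpha\in(0,1)$ and $\lambda\in(0,\infty)$ be deterministic constants, and let $S^{(N,n)}$ be the doubly aggregated centered partial sum process of independent copies of the strictly stationary INAR(1) process with Poisson innovations (defined in the context). Then $$\mathcal D_{\mathrm f}\text{-}\lim_{N\to\infty}\ \mathcal D_{\mathrm f}\text{-}\lim_{n\to\infty}\ (nN)^{-\frac12}S^{(N,n)}=\mathcal D_{\mathrm f}\text{-}\lim_{n\to\infty}\ \mathcal D_{\mathrm f}\text{-}\lim_{N\to\infty}\ (nN)^{-\frac12}S^{(N,n)}=\frac{\sqrt{\lambda(1+\alpha)}}{1-\alpha}\,B,$$ where $B=(B_t)_{t\in[0,\infty)}$ is a standard Brownian motion.
   Context: Stationary INAR(1) process with Poisson innovations: let $X_0$, $\xi_{k,j}$, $\varepsilon_k$ ($k,j\in\mathbb N=\{1,2,\dots\}$) be independent random variables such that each $\xi_{k,j}$ is Bernoulli with $\mathbb P(\xi_{k,j}=1)=\alpha=1-\mathbb P(\xi_{k,j}=0)$, each $\varepsilon_k$ is Poisson with parameter $\lambda$, and $X_0$ is Poisson with parameter $\lambda/(1-\alpha)$. Define $X_k=\sum_{j=1}^{X_{k-1}}\xi_{k,j}+\varepsilon_k$, $k\in\mathbb N$ (with $\sum_{j=1}^0:=0$). Let $(X^{(j)}_k)_{k\in\mathbb Z_+}$, $j\in\mathbb N$, be independent copies of $(X_k)_{k\in\mathbb Z_+}$, where $\mathbb Z_+=\{0,1,2,\dots\}$. Here $\mathbb E(X^{(j)}_k)=\lambda/(1-\alpha)$. For $N,n\in\mathbb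 N$ set $S^{(N,n)}_t:=\sum_{j=1}^N\sum_{k=1}^{\lfloor nt\rfloor}\bigl(X^{(j)}_k-\mathbb E(X^{(j)}_k)\bigr)$, $t\in[0,\infty)$. $\mathcal D_{\mathrm f}\text{-}\lim$ denotes weak convergence of finite dimensional distributions. In an iterated limit the inner (right-hand) limit is taken first with the other index fixed (and is asserted to exist), and then the resulting limit processes converge in finite dimensional distributions, as the outer index tends to infinity, to the stated process. *)

(* Defs.v *)
From HB Require Import structures.
From mathcomp Require Import all_boot all_order all_algebra finmap.
From mathcomp Require Import all_classical all_reals all_analysis measurable_realfun.

Set Implicit Arguments.
Unset Strict Implicit.
Unset Printing Implicit Defensive.

Import Order.TTheory GRing.Theory Num.Theory.
Import numFieldNormedType.Exports.

Local Open Scope classical_set_scope.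
Local Open Scope ring_scope.

Definition has_law {d d'} {T : measurableType d} {U : measurableType d'}
    {R : realType} (P : probability T R) (X : T -> U) (mu : set U -> \bar R) :=
  forall A, measurable A -> P (X @^-1` A) = mu A.

(* Mutual independence of a family of systems of events. Random variables are
   independent when the sigma-algebras they generate are. *)
Definition mutually_independent {d} {T : measurableType d} {R : realType}
    (P : probability T R) (I : choiceType) (F : I -> set (set T)) :=
  forall (J : {fset I}) (A : I -> set T), (forall i, i \in J -> F i (A i)) ->
    P (\bigcap_(i in [set` J]) A i) = (\prod_(i <- J) P (A i))%E.

(* The product sigma-algebra on the sequences of natural numbers. *)
Definition path_measurable : set (set (nat -> nat)) :=
  <<s \bigcup_k preimage_set_system setT (fun x : nat -> nat => x k)
        measurable >>.

Definition trajectory {T : Type} (X : nat -> T -> nat) : T -> (nat -> nat) :=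
  fun w k => X k w.

(* The copies are indexed from 0. *)
Definition independent_copies {d0 d} {T0 : measurableType d0}
    {T : measurableType d} {R : realType}
    (P0 : probability T0 R) (Y : nat -> T0 -> nat)
    (P : probability T R) (X : nat -> nat -> T -> nat) :=
  (forall j A, path_measurable A ->
     P (trajectory (X j) @^-1` A) = P0 (trajectory Y @^-1` A)) /\
  mutually_independent P
    (fun j => preimage_set_system setT (trajectory (X j)) path_measurable).

(* Time k.+1 uses xi k and eps k, and the j-th individual (j >= 0) uses xi k j:
   the innovations of time k and rank j in the usual 1-based numbering are
   xi k.-1 j.-1 and eps k.-1. *)
Fixpoint inar {T : Type} (X0 : T -> nat) (xi : nat -> nat -> T -> bool)
    (eps : nat -> T -> nat) (k : nat) (w : T) : nat :=
  if k is k'.+1 then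
    (\sum_(j < inar X0 xi eps k' w) (xi k' j w : nat) + eps k' w)%N
  else X0 w.

(* The sigma-algebras generated by X0, the xi k j and the eps k. *)
Definition innovation_sigma {d} {T : measurableType d} (X0 : T -> nat)
    (xi : nat -> nat -> T -> bool) (eps : nat -> T -> nat)
    (i : unit + nat * nat + nat) : set (set T) :=
  match i with
  | inl (inl _) => g_sigma_algebra_preimage X0
  | inl (inr (k, j)) => g_sigma_algebra_preimage (xi k j)
  | inr k => g_sigma_algebra_preimage (eps k)
  end.

(* A real-valued stochastic process with time set [0, +oo[ together with its
   probability space; the values at negative times are irrelevant. *)
Record process (R : realType) := Process {
  pdisp : measure_display;
  pspace : measurableType pdisp;
  pprob : probability pspace R;
  pval :> R -> pspace -> R;
  measurable_pval : forall t, 0 <= t -> measurable_fun setT (pval t) }.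

Program Definition scale_process {R : realType} (c : R) (Y : process R) :
    process R :=
  @Process R _ (pspace Y) (pprob Y) (fun t w => c * Y t w) _.
Next Obligation.
move=> R c Y t t0; apply: measurable_funM; first exact: measurable_cst.
exact: measurable_pval.
Qed.

(* For t >= 0, Num.truncn (n%:R * t) is the floor of n t. *)
Program Definition aggregated_sum {d} {T : measurableType d} {R : realType}
    (P : probability T R) (X : nat -> nat -> {RV P >-> nat}) (N n : nat) :
    process R :=
  @Process R d T P (fun t w =>
    \sum_(j < N) \sum_(1 <= k < (Num.truncn (n%:R * t)).+1)
      ((X j k w)%:R - fine ('E_P[(fun w' => (X j k w')%:R : R)])%E)) _.
Next Obligation.
move=> d T R P X N n t _ /=.
apply: (@measurable_sum _ _ _ setT) => j; apply: measurable_sum => k.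
apply: measurable_funB; last exact: measurable_cst.
by apply: (@measurableT_comp _ _ _ _ _ _ (fun k : nat => k%:R : R)).
Qed.

(* Convergence in distribution of finite-dimensional marginals: expectations
   of bounded continuous functions of (Y n (t 0), ..., Y n (t (m - 1)))
   converge. *)
Definition fdd_cvg {R : realType} (Y : nat -> process R) (Z : process R) :=
  forall (m : nat) (t : 'I_m -> R), (forall i, 0 <= t i) ->
  forall f : 'rV[R]_m -> R, continuous f -> (exists M : R, forall x, `|f x| <= M) ->
    ('E_(pprob (Y n))[(fun w => f (\row_i Y n (t i) w))])%E @[n --> \oo]
      --> ('E_(pprob Z)[(fun w => f (\row_i Z (t i) w))])%E.

(* D_f-lim_(a -> oo) D_f-lim_(b -> oo) Y a b = Z, with a >= 1. *)
Definition iterated_fdd_lim {R : realType} (Y : nat -> nat -> process R)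
    (Z : process R) :=
  exists L : nat -> process R,
    (forall a, (0 < a)%N -> fdd_cvg (Y a) (L a)) /\ fdd_cvg L Z.

(* The second parameter of normal_prob is the standard deviation. *)
Definition standard_brownian_motion {R : realType} (B : process R) :=
  [/\ {ae pprob B, forall w, B 0 w = 0},
      forall t : nat -> R, 0 <= t 0%N -> {homo t : i j / (i <= j)%N >-> i <= j} ->
        mutually_independent (pprob B)
          (fun i => g_sigma_algebra_preimage (fun w => B (t i.+1) w - B (t i) w)),
      forall s t : R, 0 <= s -> s < t ->
        has_law (pprob B) (fun w => B t w - B s w)
          (normal_prob 0 (Num.sqrt (t - s))) &
      {ae pprob B, forall w, {within `[0, +oo[, continuous (fun t => B t w)}}].

(* Main.v *)
Require Import Defs.
From HB Require Import structures.
From mathcomp Require Import all_boot all_order all_algebra finmap.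
From mathcomp Require Import all_classical all_reals all_analysis.
From mathcomp Require Import measurable_realfun.
From mathcomp Require Import ring lra zify.

(** The moment generating functions of all the finite-dimensional marginals are
    explicit, and both limits are read off from them.

    For the INAR(1) process this is special to Poisson innovations. The
    conditional generating function of [X_k] given [X_(k-1)] is
    [(1 + alpha (z - 1)) ^ X_(k-1) * exp (lambda (z - 1))], so the time
    variables can be eliminated from the last to the first, and the exponential
    moment of [\sum_k v_k X_k] is the exponential of a sum defined by a simple
    recursion ([inar_mgf]). Independent copies multiply ([copies_mgf]). After
    centering, a second-order expansion of the recursion gives half the
    variance [mu * \sum_(k, l) v_k v_l alpha ^ |k - l|], where
    [mu = lambda / (1 - alpha)], with an error bounded by the number of times
    multiplied by [max |v_k| ^ 3] ([inar_exponent_dist],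
    [quadratic_exponentE]). With the scaling [(n N) ^ (-1/2)] the total error is
    of order [(n N) ^ (-1/2)], so it vanishes in both limits ([log_mgf_dist]).

    If [n] tends to infinity first, the scaled variance tends to
    [lambda (1 + alpha) / (1 - alpha) ^ 2] times the covariance of Brownian
    motion, whatever [N] is: the first limit is already the announced process.
    If [N] tends to infinity first, the limit is the Gaussian process of the
    partial sums of a stationary autoregression. It is built from the given
    Brownian motion by a deterministic change of time ([ou_sum]), and its
    covariances converge as [n] tends to infinity.

    Convergence of moment generating functions implies convergence of the
    expectations of bounded continuous functions
    ([cvg_expect_bounded_continuous]). Instead of passing through
    characteristic functions, bounded continuous functions are approximated by
    linear combinations of real exponentials, uniformly with respect to an
    exponential weight: difference quotients of exponentials give the
    coordinates, hence the polynomials, their power series give the sines of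
    the coordinates, and a Bernstein polynomial in such sines approximates the
    function on a large cube while remaining bounded everywhere. The weight has
    bounded expectation along the sequence, and this plays the part of
    tightness. *)

Set Implicit Arguments.
Unset Strict Implicit.
Unset Printing Implicit Defensive.

Import Order.TTheory GRing.Theory Num.Theory.
Import numFieldNormedType.Exports.

Local Open Scope classical_set_scope.
Local Open Scope ring_scope.

(** * Tails of the exponential and sine series *)

(** From [n >= K] one gets [c ^+ K <= c ^+ n], so each term is at most [c ^- K]
    times a term of the series of [expR (c * `|x|)]. With [c = 1 / `|x|] this
    is the usual bound by a power of [x]; with [c] fixed and [K] large it is
    small uniformly in [x], relative to an exponential weight. *)
Lemma exp_tail_le {R : realType} (c x : R) (K N : nat) : 1 <= c -> (K <= N)%N ->
  \sum_(K <= n < N) `|x| ^+ n / n`!%:R <= c ^- K * expR (c * `|x|).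
Proof.
move=> c1 KN; have c0 : 0 < c by exact: lt_le_trans c1.
have x0 : 0 <= c * `|x| by rewrite mulr_ge0// ltW.
have ge0 n : 0 <= (c * `|x|) ^+ n / n`!%:R by rewrite divr_ge0 ?exprn_ge0.
have -> : expR (c * `|x|) = limn (series (exp_coeff (c * `|x|))) by [].
apply: (@le_trans _ _ (c ^- K * series (exp_coeff (c * `|x|)) N)); last first.
  rewrite ler_wpM2l ?invr_ge0 ?exprn_ge0 ?(ltW c0)//.
  apply: nondecreasing_cvgn_le; last exact: is_cvg_series_exp_coeff.
  by apply: nondecreasing_series => n _ _; exact: ge0.
rewrite /series/= [leRHS]mulrC ler_pdivlMr ?exprn_gt0//.
rewrite [leRHS](@big_cat_nat _ _ _ K 0%N)//= -[leLHS]add0r.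
rewrite lerD ?sumr_ge0//; first by move=> i _; exact: ge0.
rewrite mulr_suml.
apply: ler_sum_nat => n /andP[Kn _].
rewrite mulrAC /exp_coeff/= ler_wpM2r ?invr_ge0// exprMn mulrC ler_wpM2r ?exprn_ge0//.
by rewrite ler_weXn2l.
Qed.

Lemma series_tail_le {R : realType} (a : R ^nat) (c x : R) (K : nat) :
  1 <= c -> cvgn (series a) -> (forall n, `|a n| <= `|x| ^+ n / n`!%:R) ->
  `|limn (series a) - series a K| <= c ^- K * expR (c * `|x|).
Proof.
move=> c1 cva ax.
have cv : `|series a n - series a K| @[n --> \oo] --> `|limn (series a) - series a K|.
  by apply: cvg_norm; apply: cvgB => //; exact: cvg_cst.
rewrite -(cvg_lim _ cv)//; apply: limr_le; first by apply/cvg_ex; eexists; exact: cv.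
near=> N.
have KN : (K <= N)%N by near: N; exact: nbhs_infty_ge.
rewrite sub_series KN.
apply: le_trans (ler_norm_sum _ _ _) _.
apply: le_trans (exp_tail_le x c1 KN).
exact: ler_sum.
Unshelve. all: by end_near. Qed.

Lemma expR_tail_le {R : realType} (c x : R) (K : nat) : 1 <= c ->
  `|expR x - series (exp_coeff x) K| <= c ^- K * expR (c * `|x|).
Proof.
move=> c1; apply: series_tail_le => //; first exact: is_cvg_series_exp_coeff.
by move=> n; rewrite /exp_coeff/= normrM normrX normfV normr_nat.
Qed.

Lemma sin_tail_le {R : realType} (c x : R) (K : nat) : 1 <= c ->
  `|sin x - series (sin_coeff x) K| <= c ^- K * expR (c * `|x|).
Proof.
move=> c1; rewrite sin.unlock.
apply: series_tail_le => //; first exact: is_cvg_series_sin_coeff.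
move=> n; rewrite /sin_coeff/= !normrM !normrX normfV !normr_nat normrN1.
rewrite expr1n mulr1 ler_wpM2r ?invr_ge0// ler_piMl ?exprn_ge0//.
by case: odd.
Qed.

(** * Functions of exponential type *)

Section ExponentialType.
Variables (R : realType) (m : nat).
Implicit Types (x u : 'rV[R]_m) (g h : 'rV[R]_m -> R) (r : R).

Definition dotr u x : R := \sum_i u 0 i * x 0 i.

Definition norm1 x : R := \sum_i `|x 0 i|.

Definition expsum (s : seq (R * 'rV[R]_m)) x : R :=
  \sum_(p <- s) p.1 * expR (dotr p.2 x).

(** Membership in the closure of the linear span of the exponentials
    [x |-> expR (dotr u x)], for the sup norm weighted by [expR (r * norm1 x)].
    Expectations of such functions are controlled by a moment generating
    function alone. The growth bound is recorded because the stability under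
    products relies on it. *)
Definition exp_type r g :=
  (exists C : R, forall x, `|g x| <= C * expR (r * norm1 x)) /\
  (forall e : R, 0 < e -> exists s, forall x,
     `|g x - expsum s x| <= e * expR (r * norm1 x)).

Lemma norm1_ge0 x : 0 <= norm1 x. Proof. exact: sumr_ge0. Qed.

Lemma dotrDl u u' x : dotr (u + u') x = dotr u x + dotr u' x.
Proof. by rewrite /dotr -big_split/=; apply: eq_bigr => i _; rewrite mxE mulrDl. Qed.

Lemma expsum_cat s s' x : expsum (s ++ s') x = expsum s x + expsum s' x.
Proof. by rewrite /expsum big_cat. Qed.

Lemma expsumM s s' x :
  expsum s x * expsum s' x =
  expsum [seq (p.1 * q.1, p.2 + q.2) | p <- s, q <- s'] x.
Proof.
rewrite /expsum big_allpairs_dep/= mulr_suml; apply: eq_bigr => p _.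
rewrite mulr_sumr; apply: eq_bigr => q _.
by rewrite dotrDl expRD mulrACA.
Qed.

Lemma dotr0l x : dotr 0 x = 0.
Proof. by rewrite /dotr big1// => i _; rewrite mxE mul0r. Qed.

Lemma dotr_delta (c : R) i x : dotr (c *: delta_mx 0 i) x = c * x 0 i.
Proof.
rewrite /dotr (bigD1 i)//= big1 ?addr0; first by rewrite !mxE !eqxx mulr1.
by move=> k ki; rewrite !mxE eqxx (negbTE ki) mulr0 mul0r.
Qed.

Lemma expsum_cst (c : R) x : expsum [:: (c, 0)] x = c.
Proof.
by rewrite /expsum big_seq1/= dotr0l expR0 mulr1.
Qed.

Lemma ler_expR_norm1 r r' x : r <= r' -> expR (r * norm1 x) <= expR (r' * norm1 x).
Proof. by move=> rr'; rewrite ler_expR ler_wpM2r ?norm1_ge0. Qed.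

Lemma weighted_bound_pos r g : (exists C : R, forall x, `|g x| <= C * expR (r * norm1 x)) ->
  exists2 C : R, 0 < C & forall x, `|g x| <= C * expR (r * norm1 x).
Proof.
case=> C gC; exists (`|C| + 1); first by rewrite ltr_wpDl.
move=> x; apply: le_trans (gC x) _; rewrite ler_wpM2r ?expR_ge0//.
by rewrite (le_trans (ler_norm _))// lerDl.
Qed.

Lemma exp_type_weak r r' g : r <= r' -> exp_type r g -> exp_type r' g.
Proof.
move=> rr' [/weighted_bound_pos[C C0 gC] ag]; split.
  exists C => x; apply: le_trans (gC x) _.
  by rewrite ler_wpM2l ?ler_expR_norm1// ltW.
move=> e e0; have [s gs] := ag _ e0; exists s => x.
by apply: le_trans (gs x) _; rewrite ler_wpM2l ?ler_expR_norm1// ltW.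
Qed.

Lemma exp_type_cst r (c : R) : 0 <= r -> exp_type r (fun=> c).
Proof.
move=> r0; split.
  exists `|c| => x; rewrite ler_peMr// -[leLHS]expR0 ler_expR.
  by rewrite mulr_ge0 ?norm1_ge0.
move=> e e0; exists [:: (c, 0)] => x.
by rewrite expsum_cst subrr normr0 mulr_ge0 ?expR_ge0 ?ltW.
Qed.

Lemma exp_typeD r g h : exp_type r g -> exp_type r h ->
  exp_type r (fun x => g x + h x).
Proof.
move=> [[C gC] ag] [[D hD] ah]; split.
  by exists (C + D) => x; rewrite mulrDl (le_trans (ler_normD _ _))// lerD.
move=> e e0; have e20 : 0 < e / 2 by rewrite divr_gt0.
have [s gs] := ag _ e20; have [s' hs'] := ah _ e20.
exists (s ++ s') => x; rewrite expsum_cat opprD addrACA.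
by rewrite (le_trans (ler_normD _ _))// [e]splitr mulrDl lerD.
Qed.

(** The weight of type [r + r'] is the product of the weights of the factors,
    and a product of exponential sums is an exponential sum. *)
Lemma exp_typeM r r' g h : exp_type r g -> exp_type r' h ->
  exp_type (r + r') (fun x => g x * h x).
Proof.
move=> [/weighted_bound_pos[C C0 gC] ag] [/weighted_bound_pos[D D0 hD] ah].
have eD x : expR ((r + r') * norm1 x) = expR (r * norm1 x) * expR (r' * norm1 x).
  by rewrite mulrDl expRD.
split.
  exists (C * D) => x; rewrite normrM eD mulrACA.
  by rewrite ler_pM.
move=> e e0; pose d := Num.min 1 (e / (C + D + 1)).
have CD0 : 0 < C + D + 1 by rewrite !addr_gt0.
have d0 : 0 < d by rewrite lt_min ltr01 divr_gt0.
have [s gs] := ag _ d0; have [s' hs'] := ah _ d0.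
exists [seq (p.1 * q.1, p.2 + q.2) | p <- s, q <- s'] => x.
rewrite -expsumM.
have -> : g x * h x - expsum s x * expsum s' x =
    g x * (h x - expsum s' x) + (g x - expsum s x) * expsum s' x by ring.
apply: le_trans (ler_normD _ _) _; rewrite !normrM eD.
have s'le : `|expsum s' x| <= (D + d) * expR (r' * norm1 x).
  rewrite -[expsum s' x](subrK (h x)) addrC mulrDl.
  by rewrite (le_trans (ler_normD _ _))// lerD// distrC.
apply: (@le_trans _ _ ((C * d + d * (D + d)) *
    (expR (r * norm1 x) * expR (r' * norm1 x)))).
  by rewrite mulrDl lerD// mulrACA ler_pM.
rewrite ler_wpM2r ?mulr_ge0 ?expR_ge0//.
have : d * (C + D + 1) <= e.
  by rewrite -ler_pdivlMr// ge_min lexx orbT.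
have : d <= 1 by rewrite ge_min lexx.
nra.
Qed.

Lemma exp_type_lim r g :
  (exists C : R, forall x, `|g x| <= C * expR (r * norm1 x)) ->
  (forall e : R, 0 < e -> exists2 h, exp_type r h &
     forall x, `|g x - h x| <= e * expR (r * norm1 x)) ->
  exp_type r g.
Proof.
move=> gC ag; split=> // e e0; have e20 : 0 < e / 2 by rewrite divr_gt0.
have [h [_ ah] gh] := ag _ e20; have [s hs] := ah _ e20.
exists s => x; rewrite [e]splitr mulrDl -(subrKA (h x)).
by rewrite (le_trans (ler_normD _ _))// lerD.
Qed.

Lemma ler_norm_coord x i : `|x 0 i| <= norm1 x.
Proof. by rewrite /norm1 (bigD1 i)//= lerDl sumr_ge0. Qed.

(** The difference quotients [(expR (h * x 0 i) - 1) / h] converge to [x 0 i]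
    as [h] tends to 0, with an error of order [h] relative to the weight. The
    type is arbitrarily small, so that all the powers of a coordinate share a
    common type (see [exp_typeX]); this is what makes power series
    available. *)
Lemma exp_type_coord r i : 0 < r -> exp_type r (fun x => x 0 i).
Proof.
move=> r0; split.
  exists r^-1 => x; rewrite mulrC ler_pdivlMr// mulrC.
  apply: le_trans (_ : _ <= 1 + r * norm1 x) (expR_ge1Dx _).
  by rewrite (@le_trans _ _ (r * norm1 x)) ?lerDr// ler_wpM2l ?ler_norm_coord// ltW.
move=> e e0; pose h := Num.min r (e * r ^+ 2).
have h0 : 0 < h by rewrite lt_min r0 mulr_gt0// exprn_gt0.
exists [:: (h^-1, h *: delta_mx 0 i); (- h^-1, 0)] => x.
rewrite /expsum big_cons big_seq1/= dotr_delta dotr0l expR0 mulr1.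
have := expR_tail_le (h * x 0 i) 2 (_ : 1 <= r / h).
rewrite ler_pdivlMr// mul1r ge_min lexx => /(_ isT).
rewrite /series/= !big_nat_recr//= big_geq// /exp_coeff/= expr0 expr1 !divr1 add0r => H.
have -> : x 0 i - (h^-1 * expR (h * x 0 i) - h^-1) =
  - h^-1 * (expR (h * x 0 i) - (1 + h * x 0 i)).
  by field; rewrite gt_eqF.
rewrite normrM normrN (@gtr0_norm _ h^-1) ?invr_gt0//. rewrite ler_pdivrMl// mulrA [h * e]mulrC.
apply: le_trans H _.
rewrite -exprVn invf_div normrM gtr0_norm// mulrA divfK ?gt_eqF//.
apply: ler_pM; rewrite ?exprn_ge0 ?expR_ge0 ?divr_ge0 ?(ltW h0) ?(ltW r0)//.
  rewrite expr_div_n ler_pdivrMr ?exprn_gt0// expr2 mulrAC ler_wpM2r ?(ltW h0)//.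
  by rewrite ge_min lexx orbT.
by rewrite ler_expR ler_wpM2l ?ler_norm_coord ?(ltW r0).
Qed.

(** The type [r] is shared among the factors; this is possible because the type
    of a coordinate is arbitrarily small. *)
Lemma exp_typeX r n i : 0 < r -> exp_type r (fun x => x 0 i ^+ n).
Proof.
elim: n r => [|n IH] r r0; first by apply: exp_type_cst; exact: ltW.
rewrite [r]splitr; under eq_fun do rewrite exprS.
by apply: exp_typeM; [apply: exp_type_coord|apply: IH]; rewrite divr_gt0.
Qed.

Lemma exp_typeZ r (c : R) g : exp_type r g -> exp_type r (fun x => c * g x).
Proof.
by move=> tg; rewrite -[r]add0r; apply: exp_typeM => //; exact: exp_type_cst.
Qed.

Lemma exp_type_sum r (I : Type) (s : seq I) (F : I -> 'rV[R]_m -> R) : 0 <= r ->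
  (forall i, exp_type r (F i)) -> exp_type r (fun x => \sum_(i <- s) F i x).
Proof.
move=> r0 tF; elim: s => [|i s IH].
  by under eq_fun do rewrite big_nil; exact: exp_type_cst.
by under eq_fun do rewrite big_cons; exact: exp_typeD.
Qed.

(** The partial sums of the sine series are polynomials, hence of the same
    small type, and they converge relative to the weight of type
    [2 * (`|c| + 1)]. *)
Lemma exp_type_sin (c : R) i : exists r, exp_type r (fun x => sin (c * x 0 i)).
Proof.
exists (2 * (`|c| + 1)); have c0 : 0 < 2 * (`|c| + 1) by rewrite mulr_gt0// ltr_wpDl.
apply: exp_type_lim.
  exists 1 => x; rewrite mul1r (@le_trans _ _ 1)//.
    by rewrite ler_norml sin_geN1 sin_le1.
  by rewrite -[leLHS]expR0 ler_expR mulr_ge0 ?norm1_ge0 ?ltW.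
move=> e e0; have [K Ke] : exists K : nat, (2 : R) ^- K <= e.
  have [N _ /(_ N (leqnn _))] := near_infty_natSinv_expn_lt (PosNum e0).
  by rewrite div1r => /ltW; exists N.
exists (fun x => series (sin_coeff (c * x 0 i)) K).
  apply: exp_type_sum; first exact: ltW.
  move=> k; rewrite /sin_coeff/=; under eq_fun do rewrite exprMn mulrA mulrAC.
  by apply: exp_typeZ; apply: exp_typeX.
move=> x; apply: le_trans (sin_tail_le (c * x 0 i) K (_ : 1 <= 2)) _.
  by rewrite ler1n.
apply: ler_pM; rewrite ?invr_ge0 ?exprn_ge0 ?expR_ge0//.
rewrite ler_expR -mulrA ler_wpM2l// normrM ler_pM ?ler_norm_coord//.
by rewrite lerDl.
Qed.
End ExponentialType.

(** * Weighted approximation of bounded continuous functions *)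

Section RandomWalkMean.
Variables (R : realType) (I : eqType).
Implicit Types (y : I -> R) (s : seq I) (G H : (I -> nat) -> R) (k : I -> nat).

(** The mean of [G] at the end of a random walk on [I -> nat] started at [k]:
    for each entry [i] of [s], the coordinate [i] is increased by 1 with
    probability [y i]. When each coordinate occurs [K] times in [s], this is
    the multivariate Bernstein polynomial of [G] in the variables [y]. *)
Fixpoint walk_mean y s G k : R :=
  if s is i :: s' then
    (1 - y i) * walk_mean y s' G k + y i * walk_mean y s' G (fun j => (k j + (j == i))%N)
  else G k.

Lemma walk_mean_le y s G H k : (forall i, 0 <= y i <= 1) -> (forall k', G k' <= H k') ->
  walk_mean y s G k <= walk_mean y s H k.
Proof.
move=> y01 GH; elim: s k => [|i s IH] k //=; have /andP[y0 y1] := y01 i.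
by rewrite lerD// ler_wpM2l// subr_ge0.
Qed.

Lemma walk_mean_cst y s (a : R) k : walk_mean y s (fun=> a) k = a.
Proof. by elim: s k => [|i s IH] k //=; rewrite !IH; ring. Qed.

Lemma walk_mean_linear y s (a : R) G H k :
  walk_mean y s (fun k' => a * G k' + H k') k = a * walk_mean y s G k + walk_mean y s H k.
Proof. by elim: s k => [|i s IH] k //=; rewrite !IH; ring. Qed.

Lemma walk_mean_sum y s (J : Type) (r : seq J) (F : J -> (I -> nat) -> R) k :
  walk_mean y s (fun k' => \sum_(j <- r) F j k') k = \sum_(j <- r) walk_mean y s (F j) k.
Proof.
elim: r => [|j r IH].
  by rewrite big_nil -[RHS](walk_mean_cst y s 0 k); congr walk_mean; apply/funext => k'; rewrite big_nil.
rewrite big_cons -IH -[walk_mean y s (F j) k]mul1r -walk_mean_linear; congr walk_mean.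
by apply/funext => k'; rewrite big_cons mul1r.
Qed.

Lemma walk_mean_dist y s G (a : R) k : (forall i, 0 <= y i <= 1) ->
  `|walk_mean y s G k - a| <= walk_mean y s (fun k' => `|G k' - a|) k.
Proof.
move=> y01; have e (b c : R) : b * walk_mean y s G k + c = walk_mean y s (fun k' => b * G k' + c) k.
  by rewrite walk_mean_linear walk_mean_cst.
apply/ler_normlP; split.
  rewrite opprB addrC -mulN1r e; apply: walk_mean_le => // k'.
  by rewrite mulN1r addrC distrC ler_norm.
by rewrite -[walk_mean _ _ _ _]mul1r e; apply: walk_mean_le => // k'; rewrite mul1r ler_norm.
Qed.

(** The number of increments of the coordinate [i] is binomial: its mean and its
    variance appear on the right-hand side. *)
Lemma walk_mean_sqr y s i (c : R) k :
  walk_mean y s (fun k' => ((k' i)%:R - c) ^+ 2) k =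
  ((k i)%:R + (count_mem i s)%:R * y i - c) ^+ 2 +
  (count_mem i s)%:R * (y i * (1 - y i)).
Proof.
elim: s k => [|j s IH] k /=; first by rewrite !mul0r !addr0.
rewrite !IH natrD; have [->|ji] := eqVneq j i; rewrite ?eqxx /=.
  by rewrite !natrD/=; ring.
by rewrite !add0n; ring.
Qed.

End RandomWalkMean.

Section Modulus.
Variables (R : realType) (m : nat) (f : 'rV[R]_m -> R) (phi : R -> R).
Variables (A M : R).

Let Q : set 'rV[R]_m := [set x | forall i, x ord0 i \in `[- A, A]].

(** Uniform continuity of [f] on a cube, in a form that can be averaged. On the
    compact set of the pairs with [e <= `|f x - f x'|] the continuous function
    [\sum_i (phi (x 0 i) - phi (x' 0 i)) ^+ 2] has a positive minimum, since
    [phi] is injective; a multiple of it then exceeds twice the bound of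
    [f]. *)
Lemma quadratic_modulus (e : R) : continuous f -> (forall x, `|f x| <= M) ->
  continuous phi -> {in `[- A, A] &, injective phi} -> 0 < e ->
  exists2 C : R, 0 <= C & forall x x', Q x -> Q x' ->
    `|f x - f x'| <= e + C * \sum_i (phi (x 0 i) - phi (x' 0 i)) ^+ 2.
Proof.
move=> cf fM cphi iphi e0.
pose F (p : 'rV[R]_m * 'rV[R]_m) := `|f p.1 - f p.2|.
pose h (p : 'rV[R]_m * 'rV[R]_m) := \sum_i (phi (p.1 0 i) - phi (p.2 0 i)) ^+ 2.
have h_ge0 p : 0 <= h p by apply: sumr_ge0 => i _; exact: sqr_ge0.
have cF : continuous F.
  move=> p; apply: cvg_norm; apply: cvgB; apply: continuous_comp; try exact: cf.
    exact: cvg_fst.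
  exact: cvg_snd.
have ch : continuous h.
  move=> p; apply: cvg_big => [|i _]; first exact: add_continuous.
  have cp1 : {for p, continuous (fun p : 'rV[R]_m * 'rV[R]_m => phi (p.1 0 i))}.
    apply: (@continuous_comp _ _ _ (fun p : 'rV[R]_m * 'rV[R]_m => p.1 0 i) phi); last exact: cphi.
    apply: (@continuous_comp _ _ _ fst (fun x : 'rV[R]_m => x 0 i)); first exact: cvg_fst.
    exact: coord_continuous.
  have cp2 : {for p, continuous (fun p : 'rV[R]_m * 'rV[R]_m => phi (p.2 0 i))}.
    apply: (@continuous_comp _ _ _ (fun p : 'rV[R]_m * 'rV[R]_m => p.2 0 i) phi); last exact: cphi.
    apply: (@continuous_comp _ _ _ snd (fun x : 'rV[R]_m => x 0 i)); first exact: cvg_snd.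
    exact: coord_continuous.
  by rewrite expr2; apply: cvgM; apply: cvgB.
pose D := (Q `*` Q) `&` (F @^-1` [set z | e <= z]).
have cD : compact D.
  apply: compact_closedI.
    have cQ : compact Q.
      by apply: (@rV_compact _ _ (fun=> `[- A, A]%classic)) => _; exact: segment_compact.
    exact: compact_setX.
  by apply: preimage_closed; [move=> p _; exact: cF|exact: closed_ge].
have [D0|noD] := pselect (D !=set0); last first.
  exists 0 => // x x' Qx Qx'; rewrite mul0r addr0 leNgt; apply/negP => ex.
  by apply: noD; exists (x, x'); split; [split|exact: ltW].
have [p pD pmin] := compact_EVT_min D0 cD (continuous_subspaceT ch).
have hp0 : 0 < h p.
  move: pD; rewrite inE => -[[Q1 Q2] /= ep]; rewrite lt_neqAle h_ge0 andbT eq_sym.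
  apply/eqP => /psumr_eq0P hp; suff p12 : p.1 = p.2.
    by move: ep; rewrite /F p12 subrr normr0 leNgt e0.
  apply/rowP => i; apply: iphi; [exact: Q1|exact: Q2|].
  by apply/eqP; rewrite -subr_eq0 -sqrf_eq0 hp// => j _; exact: sqr_ge0.
have M0 : 0 <= M by apply: le_trans (fM 0).
exists (2 * M / h p); first by rewrite divr_ge0 ?mulr_ge0 ?(ltW hp0).
move=> x x' Qx Qx'; have [xe|ex] := leP `|f x - f x'| e.
  rewrite (le_trans xe)// lerDl mulr_ge0 ?divr_ge0 ?mulr_ge0 ?(ltW hp0)//.
  exact: (h_ge0 (x, x')).
have hx : h p <= h (x, x').
  by apply: pmin; rewrite inE; split; [split|exact: ltW].
rewrite (@le_trans _ _ (2 * M))//.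
  by rewrite (le_trans (ler_normB _ _))// mulr2n mulrDl mul1r lerD.
rewrite -[leLHS]add0r lerD ?(ltW e0)// mulrAC ler_pdivlMr//.
by rewrite ler_wpM2l// mulr_ge0.
Qed.

End Modulus.

Section ExponentialApproximation.
Variables (R : realType) (m : nat).

(** The mean is a polynomial in the values [y i x]. *)
Lemma exp_type_walk_mean (y : 'I_m -> 'rV[R]_m -> R) s G k :
  (forall i, exists r, exp_type r (y i)) ->
  exists r, exp_type r (fun x => walk_mean (y^~ x) s G k).
Proof.
move=> ty; elim: s k => [|i s IH] k /=; first by exists 0; exact: exp_type_cst.
have [r1 t1] := ty i; have [r2 t2] := IH k.
have [r3 t3] := IH (fun j => (k j + (j == i))%N).
have t1' : exp_type (Num.max 0 r1) (fun x => 1 - y i x).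
  under eq_fun do rewrite -mulN1r.
  apply: exp_typeD; first by apply: exp_type_cst; rewrite le_max lexx.
  by apply: exp_typeZ; apply: exp_type_weak t1; rewrite le_max lexx orbT.
have := exp_typeM t1' t2; have := exp_typeM t1 t3.
set a := r1 + r3; set b := Num.max 0 r1 + r2 => ta tb.
exists (Num.max a b); apply: exp_typeD.
  by apply: exp_type_weak tb; rewrite le_max lexx orbT.
by apply: exp_type_weak ta; rewrite le_max lexx.
Qed.

Lemma count_enum_flatten (K : nat) (i : 'I_m) :
  count_mem i (flatten (nseq K (enum 'I_m))) = K.
Proof.
rewrite count_flatten map_nseq sumn_nseq count_uniq_mem ?enum_uniq// mem_enum.
by rewrite mul1n.
Qed.

(** On a large cube the variables [y i x = (1 + sin (c * x 0 i)) / 2] are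
    coordinates with values in the unit interval, and the Bernstein polynomial
    of [f] in these coordinates is close to [f]. Outside the cube the two
    functions are merely bounded, and the weight absorbs the difference. The
    sine is chosen because it is both bounded and of exponential type. *)
Lemma exp_approx_bounded_continuous (f : 'rV[R]_m -> R) (M : R) (e : R) :
  continuous f -> (forall x, `|f x| <= M) -> 0 < e ->
  exists2 g, exists r, exp_type r g &
    forall x, `|f x - g x| <= e * expR (norm1 x).
Proof.
move=> cf fM e0; have M0 : 0 <= M by apply: le_trans (fM 0).
(* Outside the cube the error is at most 2 * M, and 2 * M <= e * A. *)
pose A : R := 2 * M / e + 1; have A0 : 0 < A by rewrite ltr_wpDl// divr_ge0 ?(ltW e0) ?mulr_ge0.
pose c := pi / 2 / A; have pi20 : 0 < pi / 2 :> R by rewrite divr_gt0 ?pi_gt0.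
have cp0 : 0 < c by rewrite divr_gt0.
pose phi (z : R) := sin (c * z).
have cphi : continuous phi.
  move=> z; apply: (@continuous_comp _ _ _ (fun z => c * z) sin).
    by apply: continuousM; [exact: cvg_cst|exact: cvg_id].
  exact: continuous_sin.
have cA z : z \in `[- A, A] -> c * z \in `[- (pi / 2), pi / 2].
  rewrite !in_itv/= /c => /andP[z1 z2]; rewrite mulrAC ler_pdivrMr// ler_pM2l// z2.
  by rewrite ler_pdivlMr// mulNr -mulrN ler_pM2l// z1.
have iphi : {in `[- A, A] &, injective phi}.
  move=> z z' /cA zA /cA z'A /(congr1 asin).
  by rewrite !sinK// => /(mulfI (lt0r_neq0 cp0)).
have [|C C0 fC] := @quadratic_modulus R m f phi A M (e / 2) cf fM cphi iphi.
  by rewrite divr_gt0.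
pose y i (x : 'rV[R]_m) := (1 + phi (x 0 i)) / 2.
have y01 x i : 0 <= y i x <= 1.
  have := sin_geN1 (c * x 0 i); have := sin_le1 (c * x 0 i).
  by rewrite /y /phi => ? ?; apply/andP; split; lra.
(* The variance contributes C * m / K to the error on the cube. *)
have [K K0 KC] : exists2 K : nat, (0 < K)%N & 2 * C * m%:R / e <= K%:R.
  exists (Num.truncn (2 * C * m%:R / e)).+1 => //; apply: ltW.
  by rewrite truncnS_gt.
have KR0 : 0 < K%:R :> R by rewrite ltr0n.
(* The walk makes at most K increments per coordinate; capping the count keeps
   the nodes inside the cube for every k, so that comparisons of the functions
   averaged by the walk need no restriction on k. *)
pose q (k : 'I_m -> nat) i : R := (minn (k i) K)%:R / K%:R.
have q01 k i : 0 <= q k i <= 1.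
  by rewrite divr_ge0//= ler_pdivrMr// mul1r ler_nat geq_minr.
have q2 k i : -1 <= 2 * q k i - 1 <= 1.
  by have /andP[? ?] := q01 k i; apply/andP; split; lra.
pose node k : 'rV[R]_m := \row_i (asin (2 * q k i - 1) / c).
have nodeQ k i : node k ord0 i \in `[- A, A].
  have h := @asin_def R _ (q2 k i).
  rewrite mxE in_itv/= ler_pdivlMr// ler_pdivrMr//.
  have -> : A * c = pi / 2 by rewrite /c; field; rewrite gt_eqF.
  have -> : - A * c = - (pi / 2) by rewrite /c; field; rewrite gt_eqF.
  by case: h.
have nodeE k i : phi (node k 0 i) = 2 * q k i - 1.
  by rewrite /phi mxE mulrC divfK ?gt_eqF// asinK// in_itv/= q2.
pose s := flatten (nseq K (enum 'I_m)).
pose G k := f (node k).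
exists (fun x => walk_mean (y^~ x) s G (fun=> 0%N)).
  apply: exp_type_walk_mean => i; have [r tr] := exp_type_sin c i.
  exists (Num.max 0 r); rewrite /y; under eq_fun do rewrite mulrC.
  apply: exp_typeZ; apply: exp_typeD; first by apply: exp_type_cst; rewrite le_max lexx.
  by apply: exp_type_weak tr; rewrite le_max lexx orbT.
move=> x; rewrite distrC.
have [xQ|] := pselect (forall i, x ord0 i \in `[- A, A]); last first.
  move=> /existsNP[i /negP]; rewrite in_itv/= -ler_norml -ltNge => Ax.
  apply: (@le_trans _ _ (2 * M)).
    apply: (le_trans (@walk_mean_dist _ _ (y^~ x) s G (f x) (fun=>0%N) (y01 x))).
    rewrite -[leRHS](walk_mean_cst (y^~ x) s _ (fun=> 0%N)).
    apply: walk_mean_le; first exact: y01.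
    by move=> k; rewrite (le_trans (ler_normB _ _))// mulr2n mulrDl mul1r lerD ?fM// /G fM.
  apply: (@le_trans _ _ (e * norm1 x)).
    rewrite -ler_pdivrMl// (le_trans _ (ler_norm_coord x i))//.
    by rewrite (le_trans _ (ltW Ax))// /A mulrC lerDl.
  rewrite ler_wpM2l ?(ltW e0)// (le_trans _ (expR_ge1Dx _))//.
  by rewrite lerDr.
apply: le_trans (@walk_mean_dist _ _ (y^~ x) s _ _ _ (y01 x)) _.
pose H (k : 'I_m -> nat) : R :=
  4 * C / K%:R ^+ 2 * \sum_i ((k i)%:R - K%:R * y i x) ^+ 2 + e / 2.
apply: (@le_trans _ _ (walk_mean (y^~ x) s H (fun=> 0%N))).
  apply: walk_mean_le; first exact: y01.
  move=> k; apply: le_trans (fC _ _ (nodeQ k) xQ) _.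
  rewrite addrC /H lerD2r [4 * C]mulrC -!mulrA ler_wpM2l// !mulr_sumr.
  apply: ler_sum => i _; rewrite nodeE.
  have -> : phi (x 0 i) = 2 * y i x - 1 by rewrite /y; field.
  have -> : (2 * q k i - 1 - (2 * y i x - 1)) ^+ 2 = 4 * (q k i - y i x) ^+ 2 by ring.
  have -> : 4 * (K%:R ^- 2 * ((k i)%:R - K%:R * y i x) ^+ 2) =
            4 * ((k i)%:R / K%:R - y i x) ^+ 2.
    by field; rewrite gt_eqF.
  rewrite ler_wpM2l//.
  have /andP[y0 y1] := y01 x i.
  have [kK|Kk] := leqP (k i) K; first by rewrite /q (minn_idPl kK).
  rewrite /q (minn_idPr (ltnW Kk)) divff ?gt_eqF//.
  rewrite ler_sqr ?nnegrE ?subr_ge0//.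
    by rewrite lerD2r ler_pdivlMr// mul1r ler_nat ltnW.
  by rewrite (le_trans y1)// ler_pdivlMr// mul1r ler_nat ltnW.
rewrite /H walk_mean_linear walk_mean_sum walk_mean_cst.
apply: (@le_trans _ _ e); last by rewrite ler_peMr ?(ltW e0)// -expR0 ler_expR norm1_ge0.
rewrite [leRHS]splitr lerD2r.
apply: (@le_trans _ _ (4 * C / K%:R ^+ 2 * \sum_(i < m) (K%:R / 4))).
  rewrite ler_wpM2l ?divr_ge0 ?mulr_ge0 ?exprn_ge0//.
  apply: ler_sum => i _; rewrite walk_mean_sqr count_enum_flatten add0r subrr expr0n add0r.
  rewrite ler_wpM2l//; have := sqr_ge0 (y i x - 1 / 2); lra.
rewrite sumr_const card_ord -[_ *+ m]mulr_natr.
have -> : 4 * C / K%:R ^+ 2 * (K%:R / 4 * m%:R) = C * m%:R / K%:R.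
  by field; rewrite gt_eqF.
move: KC; rewrite !ler_pdivrMr//; lra.
Qed.

End ExponentialApproximation.

(** * Convergence of marginals from moment generating functions *)

Section FiniteMarginals.
Variables (R : realType) (m : nat) (t : 'I_m -> R).
Hypothesis t_ge0 : forall i, 0 <= t i.
Implicit Types (Z : process R) (g f : 'rV[R]_m -> R).

Definition marginal Z w : 'rV[R]_m := \row_i Z (t i) w.
Arguments marginal : clear implicits.

Definition integ Z g := (pprob Z).-integrable setT (EFin \o (g \o marginal Z)).

Definition expect Z g : R := (\int[pprob Z]_w g (marginal Z w))%R.

(** As an equation between extended reals, this includes the finiteness of all
    the exponential moments. *)
Definition mgf Z (L : 'rV[R]_m -> R) :=
  forall u, (\int[pprob Z]_w (expR (dotr u (marginal Z w)))%:E = (L u)%:E)%E.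

Lemma measurable_dotr Z u : measurable_fun setT (fun w => dotr u (marginal Z w)).
Proof.
apply: measurable_sum => i; apply: measurable_funM; first exact: measurable_cst.
under eq_fun do rewrite mxE.
exact: measurable_pval.
Qed.

Lemma measurable_norm1 Z : measurable_fun setT (fun w => norm1 (marginal Z w)).
Proof.
apply: measurable_sum => i; under eq_fun do rewrite mxE.
by apply: measurableT_comp => //; exact: measurable_pval.
Qed.

Lemma integD Z g h : integ Z g -> integ Z h -> integ Z (fun x => g x + h x).
Proof. by move=> ig ih; apply: eq_integrable (integrableD measurableT ig ih). Qed.

Lemma integZ Z (c : R) g : integ Z g -> integ Z (fun x => c * g x).
Proof. by move=> ig; apply: eq_integrable (integrableZl measurableT c ig). Qed.

Lemma integ_exp Z L u : mgf Z L -> integ Z (fun x => expR (dotr u x)).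
Proof.
move=> ZL; apply/integrableP; split.
  apply/measurable_EFinP; apply: measurableT_comp => //; exact: measurable_dotr.
under eq_integral do rewrite /= ger0_norm ?expR_ge0//.
by rewrite ZL ltry.
Qed.

Lemma expect_exp Z L u : mgf Z L -> expect Z (fun x => expR (dotr u x)) = L u.
Proof. by move=> ZL; rewrite /expect /Rintegral ZL. Qed.

Lemma integ_cst Z (c : R) : integ Z (fun=> c).
Proof.
by apply: (eq_integrable _ (EFin \o cst c)) => //; exact: finite_measure_integrable_cst.
Qed.

Lemma expectD Z g h : integ Z g -> integ Z h ->
  expect Z (fun x => g x + h x) = expect Z g + expect Z h.
Proof. by move=> ig ih; exact: RintegralD. Qed.

Lemma expectZ Z (c : R) g : integ Z g -> expect Z (fun x => c * g x) = c * expect Z g.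
Proof. by move=> ig; exact: RintegralZl. Qed.

Lemma le_expect Z g h : integ Z g -> integ Z h -> (forall x, g x <= h x) ->
  expect Z g <= expect Z h.
Proof. by move=> ig ih gh; apply: le_Rintegral => // w _; exact: gh. Qed.

Lemma integ_sum Z (I : Type) (s : seq I) (F : I -> 'rV[R]_m -> R) :
  (forall i, integ Z (F i)) -> integ Z (fun x => \sum_(i <- s) F i x).
Proof.
move=> iF; elim: s => [|i s IH].
  by under eq_fun do rewrite big_nil; exact: integ_cst.
by under eq_fun do rewrite big_cons; exact: integD.
Qed.

Lemma expect_cst Z (c : R) : expect Z (fun=> c) = c.
Proof.
by rewrite /expect Rintegral_cst// [X in fine X](@probability_setT _ _ _ (pprob Z)) mulr1.
Qed.

Lemma expect_sum Z (I : Type) (s : seq I) (F : I -> 'rV[R]_m -> R) :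
  (forall i, integ Z (F i)) ->
  expect Z (fun x => \sum_(i <- s) F i x) = \sum_(i <- s) expect Z (F i).
Proof.
move=> iF; elim: s => [|i s IH].
  by under eq_fun do rewrite big_nil; rewrite big_nil expect_cst.
under eq_fun do rewrite big_cons; rewrite big_cons expectD ?IH//.
exact: integ_sum.
Qed.

Definition signs (r : R) (b : {ffun 'I_m -> bool}) : 'rV[R]_m :=
  \row_i (if b i then r else - r).

(** One of the choices of signs turns [dotr (signs r b) x] into [r * norm1 x],
    and the other terms are positive. *)
Lemma expR_norm1_le (r : R) x :
  expR (r * norm1 x) <= \sum_b expR (dotr (signs r b) x).
Proof.
rewrite (bigD1 [ffun i => 0 <= x 0 i])//= -[leLHS]addr0 lerD//; last first.
  by apply: sumr_ge0 => b _; exact: expR_ge0.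
rewrite ler_expR /dotr /norm1 mulr_sumr; apply: ler_sum => i _.
rewrite mxE ffunE; case: (lerP 0 (x 0 i)) => h; first by rewrite ger0_norm.
by rewrite ltr0_norm// mulrN mulNr.
Qed.

Lemma integ_dom Z g h : measurable_fun setT (g \o marginal Z) -> integ Z h ->
  (forall x, `|g x| <= h x) -> integ Z g.
Proof.
move=> mg ih gh; apply: le_integrable ih => //; first exact/measurable_EFinP.
move=> w _; rewrite /= lee_fin (le_trans (gh _))// ler_norm//.
Qed.

Lemma integ_norm1 Z L (r : R) : mgf Z L ->
  integ Z (fun x => expR (r * norm1 x)) /\
  expect Z (fun x => expR (r * norm1 x)) <= \sum_b L (signs r b).
Proof.
move=> ZL.
have i2 : integ Z (fun x => \sum_b expR (dotr (signs r b) x)).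
  by apply: integ_sum => b; exact: integ_exp ZL.
have i1 : integ Z (fun x => expR (r * norm1 x)).
  apply: (integ_dom _ i2); last by move=> x; rewrite ger0_norm ?expR_ge0 ?expR_norm1_le.
  apply: measurableT_comp => //; apply: measurable_funM => //; exact: measurable_norm1.
split=> //; apply: le_trans (le_expect i1 i2 (@expR_norm1_le r)) _.
rewrite expect_sum; last by move=> b; exact: integ_exp ZL.
by apply: ler_sum => b _; rewrite (expect_exp _ ZL).
Qed.

(** Integrability includes measurability, which is inherited from the
    approximations as a pointwise limit. *)
Lemma integ_lim Z L (r : R) f : mgf Z L ->
  (forall e : R, 0 < e -> exists2 g, integ Z g &
     forall x, `|f x - g x| <= e * expR (r * norm1 x)) ->
  integ Z f.
Proof.
move=> ZL fg; have [iW _] := integ_norm1 r ZL.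
have [g g1 g2] := fg 1 ltr01.
apply: (@integ_dom _ _ (fun x => `|g x| + 1 * expR (r * norm1 x))); last first.
- move=> x; rewrite -[f x](subrK (g x)) addrC (le_trans (ler_normD _ _))//.
  by rewrite lerD.
- by apply: integD; [by apply: eq_integrable (integrable_abse g1)|exact: integZ].
have /choice[G HG] : forall k : nat, exists g, integ Z g /\
    forall x, `|f x - g x| <= k.+1%:R^-1 * expR (r * norm1 x).
  by move=> k; have [|h h1 h2] := fg k.+1%:R^-1; [rewrite invr_gt0|exists h].
apply: (@measurable_fun_cvg _ _ _ _ (fun k => G k \o marginal Z)) => //.
  by move=> k; have [/measurable_int/measurable_EFinP] := HG k.
move=> w _; apply/cvgrPdist_le => e e0 /=.
have e'0 : 0 < e / expR (r * norm1 (marginal Z w)) by rewrite divr_gt0 ?expR_gt0.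
near=> k; have [_ Hk] := HG k; apply: le_trans (Hk _) _.
rewrite -ler_pdivlMr ?expR_gt0//; apply: ltW; near: k.
exact: (near_infty_natSinv_lt (PosNum e'0)).
Unshelve. all: by end_near. Qed.

Lemma expect_dist Z (r d : R) f g : integ Z f -> integ Z g ->
  integ Z (fun x => expR (r * norm1 x)) ->
  (forall x, `|f x - g x| <= d * expR (r * norm1 x)) ->
  `|expect Z f - expect Z g| <= d * expect Z (fun x => expR (r * norm1 x)).
Proof.
move=> iF ig iW fg; have idW := integZ d iW.
have Efg (h k : 'rV[R]_m -> R) : integ Z h -> integ Z k ->
    (forall x, `|h x - k x| <= d * expR (r * norm1 x)) ->
    expect Z h <= expect Z k + d * expect Z (fun x => expR (r * norm1 x)).
  move=> ih ik hk; rewrite -expectZ// -expectD//; apply: le_expect => //.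
    exact: integD.
  by move=> x; have := hk x; rewrite ler_distl => /andP[].
by rewrite ler_distl lerBlDr !Efg// => x; rewrite distrC.
Qed.

Section Convergence.
Variables (Y : nat -> process R) (Z : process R).
Variables (L : nat -> 'rV[R]_m -> R) (LZ : 'rV[R]_m -> R).
Hypotheses (YL : forall n, mgf (Y n) (L n)) (ZL : mgf Z LZ).
Hypothesis L_cvg : forall u, L n u @[n --> \oo] --> LZ u.

Definition cvg_expect g := [/\ forall n, integ (Y n) g, integ Z g &
  expect (Y n) g @[n --> \oo] --> expect Z g].

Lemma cvg_expect_expsum s : cvg_expect (expsum s).
Proof.
elim: s => [|[c u] s [i1 i2 c3]].
  rewrite /cvg_expect; have -> : expsum [::] = (fun=> 0 : R) :> ('rV[R]_m -> R).
    by apply/funext => x; rewrite /expsum big_nil.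
  split.
  - by move=> n; exact: integ_cst.
  - exact: integ_cst.
  - by under eq_fun do rewrite expect_cst; rewrite expect_cst; exact: cvg_cst.
rewrite /cvg_expect; have -> : expsum ((c, u) :: s) =
    (fun x => c * expR (dotr u x) + expsum s x).
  by apply/funext => x; rewrite /expsum big_cons.
have j1 n := integ_exp u (YL n); have j2 := integ_exp u ZL.
have k1 n := integZ c (j1 n); have k2 := integZ c j2.
split; [by move=> n; exact: integD|exact: integD|].
rewrite expectD// expectZ// (expect_exp _ ZL).
under eq_fun do rewrite expectD// expectZ// (expect_exp _ (YL _)).
by apply: cvgD => //; apply: cvgM => //; exact: cvg_cst.
Qed.

(** A three-epsilon argument: the expectation of the weight is bounded along the
    sequence by a finite sum of moment generating functions, which converges.
    This plays the part of tightness. *)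
Lemma cvg_expect_lim (r : R) f :
  (forall e : R, 0 < e -> exists2 g, cvg_expect g &
     forall x, `|f x - g x| <= e * expR (r * norm1 x)) ->
  cvg_expect f.
Proof.
move=> fg.
have if1 n : integ (Y n) f.
  by apply: (integ_lim (YL n)) => e /fg[g [g1 _ _] gf]; exists g.
have if2 : integ Z f.
  by apply: (integ_lim ZL) => e /fg[g [_ g1 _] gf]; exists g.
split=> //.
have iW1 n := integ_norm1 r (YL n); have [iW2 W2] := integ_norm1 r ZL.
pose S n := \sum_b L n (signs r b); pose SZ := \sum_b LZ (signs r b).
have S_cvg : S n @[n --> \oo] --> SZ.
  apply: cvg_big => [|b _]; first exact: add_continuous.
  exact: L_cvg.
have SZ0 : 0 <= SZ by apply: le_trans W2; apply: Rintegral_ge0 => w _; exact: expR_ge0.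
apply/cvgrPdist_le => e e0.
have d0 : 0 < e / (3 * (SZ + 1)) by rewrite divr_gt0// mulr_gt0// ltr_wpDl.
have [g [ig1 ig2 g_cvg] gf] := fg _ d0.
have SZ1 : 0 < SZ + 1 by rewrite ltr_wpDl.
have dS (a : R) : a <= SZ + 1 -> e / (3 * (SZ + 1)) * a <= e / 3.
  move=> aS; have -> : e / 3 = e / (3 * (SZ + 1)) * (SZ + 1).
    by field; rewrite gt_eqF.
  by rewrite ler_wpM2l// ltW.
near=> n.
have E1 : `|expect Z f - expect Z g| <= e / 3.
  apply: le_trans (expect_dist if2 ig2 iW2 gf) _; apply: dS.
  by rewrite (le_trans W2)// lerDl.
have E2 : `|expect (Y n) f - expect (Y n) g| <= e / 3.
  have [iWn Wn] := iW1 n.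
  apply: le_trans (expect_dist (if1 n) (ig1 n) iWn gf) _; apply: dS.
  apply: le_trans Wn _; rewrite -/(S n) -lerBlDl.
  apply: le_trans (ler_norm _) _; rewrite distrC; near: n.
  by move/cvgrPdist_le : S_cvg; exact.
have E3 : `|expect Z g - expect (Y n) g| <= e / 3.
  near: n; move/cvgrPdist_le : g_cvg; apply; exact: divr_gt0.
have -> : expect Z f - expect (Y n) f = (expect Z f - expect Z g) +
  (expect Z g - expect (Y n) g) - (expect (Y n) f - expect (Y n) g) by ring.
apply: le_trans (ler_normB _ _) _; apply: le_trans (lerD (ler_normD _ _) (lexx _)) _.
lra.
Unshelve. all: by end_near. Qed.

(** Two weighted approximations are chained: a bounded continuous function by a
    function of exponential type, with the fixed weight of type 1, and the
    latter by exponential sums, with a weight depending on it. Each step uses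
    [cvg_expect_lim] with its own weight. *)
Theorem cvg_expect_bounded_continuous f : continuous f ->
  (exists M : R, forall x, `|f x| <= M) ->
  ('E_(pprob (Y n))[(fun w => f (marginal (Y n) w))])%E @[n --> \oo]
    --> ('E_(pprob Z)[(fun w => f (marginal Z w))])%E.
Proof.
move=> cf [M fM].
have [i1 i2 fc] : cvg_expect f.
  apply: (@cvg_expect_lim 1) => e e0.
  have [g [r [_ tg]] fg] := exp_approx_bounded_continuous cf fM e0.
  exists g; last by move=> x; rewrite mul1r.
  apply: (@cvg_expect_lim r) => e' /tg[s gs]; exists (expsum s) => //.
  exact: cvg_expect_expsum.
have E X : integ X f -> 'E_(pprob X)[(fun w => f (marginal X w))]%E = (expect X f)%:E.
  move=> iX; rewrite unlock /expect /Rintegral fineK//.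
  exact: (integrable_fin_num measurableT iX).
rewrite E//; under eq_fun do rewrite E//.
by apply: cvg_EFin => //; exact: nearW.
Qed.

End Convergence.
End FiniteMarginals.

(** * Expectations of products of independent variables *)

Section WeightedLaw.
Context (R : realType) d' (U : measurableType d').
Import HBNNSimple.

Let integral_mul_comp_approx d (T : measurableType d)
    (P : {measure set T -> \bar R}) (Z : T -> R) (phi : T -> U) (h : U -> \bar R)
    (mh : measurable_fun setT h) :
  measurable_fun setT Z -> (forall w, 0 <= Z w) ->
  measurable_fun setT phi -> (forall u, (0 <= h u)%E) ->
  let f_ := nnsfun_approx measurableT mh in
  (\sum_(k \in range (f_ n)) (k%:E * \int[P]_w (Z w * \1_(f_ n @^-1` [set k]) (phi w))%:E))%E
    @[n --> \oo] --> (\int[P]_w ((Z w)%:E * h (phi w)))%E.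
Proof.
move=> mZ Z0 mphi h0 f_.
have mf n : measurable_fun setT (f_ n \o phi).
  by apply: measurableT_comp => //.
have f0 n w : 0 <= f_ n (phi w) by exact: fun_ge0.
have cvf w : (f_ n (phi w))%:E @[n --> \oo] --> h (phi w).
  by apply: cvg_nnsfun_approx.
have ndf n m w : (n <= m)%N -> f_ n (phi w) <= f_ m (phi w).
  by move=> nm; exact/lefP/nd_nnsfun_approx.
have mpre n r : measurable (f_ n @^-1` [set r]).
  by rewrite -[_ @^-1` _]setTI; exact: measurable_funP.
have k0 n k : k < 0 -> f_ n @^-1` [set k] = set0 by exact: preimage_nnfun0.
have simple n : (\int[P]_w (Z w * f_ n (phi w))%:E =
     \sum_(k \in range (f_ n))
       (k%:E * \int[P]_w (Z w * \1_(f_ n @^-1` [set k]) (phi w))%:E))%E.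
  have mind r : measurable_fun setT (fun w => \1_(f_ n @^-1` [set r]) (phi w) : R).
    by apply: measurableT_comp => //; exact: measurable_indic.
  transitivity (\int[P]_w (\sum_(k \in range (f_ n))
      (Z w * (k * \1_(f_ n @^-1` [set k]) (phi w)))%:E))%E.
    apply: eq_integral => w _; rewrite fsumEFin//; congr EFin.
    by rewrite {1}fimfunE !fsbig_finite//= mulr_sumr.
  rewrite ge0_integral_fsum//; last 2 first.
  - by move=> r; apply/measurable_EFinP; apply: measurable_funM => //; apply: measurable_funM.
  - by move=> r w _; rewrite EFinM mule_ge0 ?lee_fin// -lee_fin EFinM nnfun_muleindic_ge0.
  apply: eq_fsbigr => k _; have [/k0 ->|kge0] := ltP k 0.
    rewrite !integral0_eq ?mule0// => w _; rewrite indic0 ?mulr0//.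
  under eq_integral do rewrite mulrCA EFinM.
  rewrite ge0_integralZl_EFin//.
  - by move=> w _; rewrite lee_fin mulr_ge0.
  - by apply/measurable_EFinP; exact: measurable_funM.
under eq_fun do rewrite -simple.
have -> : (\int[P]_w ((Z w)%:E * h (phi w)) =
    \int[P]_w limn (fun n => (Z w * f_ n (phi w))%:E))%E.
  apply: eq_integral => w _; apply/esym/cvg_lim => //.
  by under eq_fun do rewrite EFinM; apply: cvgeZl.
apply: cvg_monotone_convergence => //.
- by move=> n; apply/measurable_EFinP; apply: measurable_funM => //; exact: mf.
- by move=> n w _; rewrite lee_fin mulr_ge0.
- by move=> w _ n m nm; rewrite lee_fin ler_wpM2l ?ndf.
Qed.

(** Two weighted laws on [U] that agree on measurable sets have the same
    integrals. It serves with a constant weight, where it expresses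
    independence, and with a density with respect to Lebesgue measure. *)
Lemma eq_integral_weighted_law d1 (T1 : measurableType d1) d2 (T2 : measurableType d2)
    (m1 : {measure set T1 -> \bar R}) (m2 : {measure set T2 -> \bar R})
    (Z1 : T1 -> R) (Z2 : T2 -> R) (phi1 : T1 -> U) (phi2 : T2 -> U) (h : U -> \bar R) :
  measurable_fun setT Z1 -> (forall w, 0 <= Z1 w) -> measurable_fun setT phi1 ->
  measurable_fun setT Z2 -> (forall w, 0 <= Z2 w) -> measurable_fun setT phi2 ->
  measurable_fun setT h -> (forall u, (0 <= h u)%E) ->
  (forall B, measurable B ->
    (\int[m1]_w (Z1 w * \1_B (phi1 w))%:E = \int[m2]_w (Z2 w * \1_B (phi2 w))%:E)%E) ->
  (\int[m1]_w ((Z1 w)%:E * h (phi1 w)) = \int[m2]_w ((Z2 w)%:E * h (phi2 w)))%E.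
Proof.
move=> mZ1 Z10 mphi1 mZ2 Z20 mphi2 mh h0 Z12.
have c1 := @integral_mul_comp_approx _ _ m1 _ _ _ mh mZ1 Z10 mphi1 h0.
have c2 := @integral_mul_comp_approx _ _ m2 _ _ _ mh mZ2 Z20 mphi2 h0.
rewrite -(cvg_lim _ c1)// -(cvg_lim _ c2)//; congr (limn _).
apply/funext => n; apply: eq_fsbigr => k _; rewrite Z12//.
Qed.

Lemma integral_mul_comp d (T : measurableType d) (P : probability T R)
    (Z : T -> R) (phi : T -> U) (h : U -> \bar R) (c : R) :
  measurable_fun setT Z -> (forall w, 0 <= Z w) ->
  measurable_fun setT phi -> measurable_fun setT h -> (forall u, (0 <= h u)%E) ->
  (forall B, measurable B ->
    (\int[P]_w (Z w * \1_B (phi w))%:E = c%:E * P (phi @^-1` B))%E) ->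
  (\int[P]_w ((Z w)%:E * h (phi w)) = c%:E * \int[P]_w h (phi w))%E.
Proof.
move=> mZ Z0 mphi mh h0 Zc.
have c0 : 0 <= c.
  have := Zc setT measurableT; rewrite preimage_setT probability_setT mule1 => ch.
  by rewrite -lee_fin -ch integral_ge0// => w _; rewrite lee_fin mulr_ge0.
rewrite (@eq_integral_weighted_law _ _ _ _ P P Z (cst c) phi phi h)//.
  by rewrite ge0_integralZl_EFin//; exact: measurableT_comp.
move=> B mB; rewrite Zc//.
have mpre : measurable (phi @^-1` B) by rewrite -[_ @^-1` _]setTI; exact: mphi.
under [RHS]eq_integral do rewrite EFinM.
rewrite ge0_integralZl_EFin//.
  by rewrite -[in RHS]/(\int[P]_w (\1_(phi @^-1` B) w)%:E)%E integral_indic ?setIT.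
by apply/measurable_EFinP; apply: measurableT_comp => //; exact: measurable_indic.
Qed.

End WeightedLaw.

Section IndependentProducts.
Context d (T : measurableType d) (R : realType) (P : probability T R).
Variables (I : choiceType) (F : I -> set (set T)).
Hypotheses (Fm : forall i, F i `<=` measurable) (FP : mutually_independent P F).

Lemma indep_setI (s : seq I) (A : I -> set T) : uniq s ->
  (forall i, i \in s -> F i (A i)) ->
  P (\big[setI/setT]_(i <- s) A i) = (\prod_(i <- s) P (A i))%E.
Proof.
move=> us FA; have := @FP [fset i in s]%fset A.
rewrite bigcap_fset.
have ps : perm_eq [fset i in s]%fset s.
  by apply: uniq_perm => //= i; rewrite inE.
rewrite !(perm_big _ ps)/= => -> // i; rewrite inE; exact: FA.
Qed.

Variables (Y : I -> T -> R) (e : I -> R).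

(** Induction on the number of indices carrying a function instead of an
    indicator: the induction hypothesis, with the event [Y i @^-1` B] as an
    additional indicator, is what [integral_mul_comp] needs to replace that
    indicator by [Y i]. *)
Let indep_prod_indic (s1 s2 : seq I) (A : I -> set T) : uniq (s1 ++ s2) ->
  (forall i w, i \in s1 -> 0 <= Y i w) ->
  (forall i B, i \in s1 -> measurable B -> F i (Y i @^-1` B)) ->
  (forall i, i \in s1 -> (\int[P]_w (Y i w)%:E = (e i)%:E)%E) ->
  (forall i, i \in s2 -> F i (A i)) ->
  (\int[P]_w ((\prod_(i <- s1) Y i w) * (\prod_(i <- s2) \1_(A i) w))%:E =
   (\prod_(i <- s1) e i)%:E * \prod_(i <- s2) P (A i))%E.
Proof.
elim: s1 s2 A => [|i s1 IH] s2 A us Y0 FY Ye FA.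
  rewrite big_nil mul1e -indep_setI// -[in RHS](setIT (\big[_/_]_(_ <- _) _)).
  rewrite -integral_indic//; last first.
    rewrite big_seq; apply: bigsetI_measurable => j /FA; exact: Fm.
  apply: eq_integral => w _; rewrite big_nil mul1r; congr EFin.
  elim: s2 {us FA} => [|j s2 IH2]; first by rewrite !big_nil indicT.
  by rewrite !big_cons indicI/= IH2.
have [is12 us12] : i \notin s1 ++ s2 /\ uniq (s1 ++ s2) by move: us => /= /andP.
have is1 j : j \in s1 -> j \in i :: s1 by rewrite inE orbC => ->.
have Fi B : measurable B -> F i (Y i @^-1` B) by apply: FY; rewrite mem_head.
have mY j : j \in i :: s1 -> measurable_fun setT (Y j).
  by move=> js _ B mB; rewrite setTI; apply: (Fm (i := j)); exact: FY.
pose Z w := (\prod_(j <- s1) Y j w) * (\prod_(j <- s2) \1_(A j) w).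
pose c := (\prod_(j <- s1) e j) * fine (\prod_(j <- s2) P (A j))%E.
have cE : (c%:E = (\prod_(j <- s1) e j)%:E * \prod_(j <- s2) P (A j))%E.
  rewrite /c EFinM fineK// big_seq; apply: prode_fin_num => j /FA FAj.
  by apply: fin_num_measure; exact: Fm FAj.
have mZ : measurable_fun setT Z.
  apply: measurable_funM; apply: measurable_prod => j js; first exact/mY/is1.
  by apply: measurable_indic; apply: (Fm (i := j)); exact: FA.
have Z0 w : 0 <= Z w.
  rewrite /Z mulr_ge0//; last by apply: prodr_ge0.
  by rewrite big_seq prodr_ge0// => j js; apply: Y0; exact: is1.
have step := @integral_mul_comp _ _ _ _ _ P Z (Y i) (fun y => (Num.max y 0)%:E) c mZ Z0.
transitivity (\int[P]_w ((Z w)%:E * (Num.max (Y i w) 0)%:E))%E.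
  apply: eq_integral => w _; rewrite big_cons max_l ?Y0 ?mem_head//.
  by rewrite -EFinM /Z -mulrA mulrC.
rewrite step.
- rewrite cE; rewrite big_cons EFinM.
  under eq_integral do rewrite max_l ?Y0 ?mem_head//.
  by rewrite Ye ?mem_head// muleC muleA.
- by apply: mY; rewrite mem_head.
- by apply/measurable_EFinP; apply: measurable_maxr.
- by move=> y; rewrite lee_fin le_max lexx orbT.
move=> B mB; pose A' j := if j == i then Y i @^-1` B else A j.
have A's2 (V : Type) (op : V -> V -> V) (x : V) (G : set T -> V) :
    \big[op/x]_(j <- s2) G (A' j) = \big[op/x]_(j <- s2) G (A j).
  apply: eq_big_seq => j js; rewrite /A'; case: eqP => // ji.
  by move: is12; rewrite mem_cat -ji js orbT.
have H := IH (i :: s2) A'.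
transitivity (\int[P]_w ((\prod_(j <- s1) Y j w) *
    (\prod_(j <- i :: s2) \1_(A' j) w))%:E)%E.
  apply: eq_integral => w _; rewrite /Z big_cons -mulrA (A's2 _ _ _ (fun X => \1_X w)).
  by rewrite /A' eqxx [in LHS]mulrC mulrA [in RHS]mulrC mulrAC -mulrA.
rewrite H.
- by rewrite cE big_cons (A's2 _ _ _ P) /A' eqxx [(P _ * _)%E]muleC muleA.
- by rewrite -cat1s uniq_catCA/= is12.
- by move=> j w js; apply: Y0; exact: is1.
- by move=> j D js; apply: FY; exact: is1.
- by move=> j js; apply: Ye; exact: is1.
- move=> j; rewrite inE /A'; case: eqP => [-> _|_ /=]; first exact: Fi.
  exact: FA.
Qed.

Lemma indep_integral_prod (s : seq I) : uniq s ->
  (forall i w, i \in s -> 0 <= Y i w) ->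
  (forall i B, i \in s -> measurable B -> F i (Y i @^-1` B)) ->
  (forall i, i \in s -> (\int[P]_w (Y i w)%:E = (e i)%:E)%E) ->
  (\int[P]_w (\prod_(i <- s) Y i w)%:E = (\prod_(i <- s) e i)%:E)%E.
Proof.
move=> us Y0 FY Ye.
have := @indep_prod_indic s [::] (fun=> setT); rewrite cats0 big_nil mule1 => <- //.
by apply: eq_integral => w _; rewrite big_nil mulr1.
Qed.
End IndependentProducts.

(** * Grouping independent sigma-algebras *)

Section Grouping.
Context d (T : measurableType d) (R : realType) (P : probability T R).
Variables (I : choiceType) (F : I -> set (set T)) (I1 : pred I).
Hypotheses (Fm : forall i, F i `<=` measurable) (FP : mutually_independent P F).
Hypotheses (FI : forall i, setI_closed (F i)) (FT : forall i, F i setT).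

(** The sigma-algebras with index in [I1] are merged into one, with index
    [None]. The other ones are kept; an index of [I1] receives the empty
    family, which makes its independence vacuous. *)
Definition grouped (o : option I) : set (set T) :=
  if o is Some j then [set A | ~~ I1 j /\ F j A]
  else <<s \bigcup_(i in [set i | I1 i]) F i >>.

Lemma mutually_independent_seq (J : choiceType) (G : J -> set (set T)) :
  (forall s A, uniq s -> (forall i, i \in s -> G i (A i)) ->
    P (\big[setI/setT]_(i <- s) A i) = (\prod_(i <- s) P (A i))%E) ->
  mutually_independent P G.
Proof. by move=> H s A GA; rewrite bigcap_fset; apply: H => //; exact: fset_uniq. Qed.

Let bigE (s : seq I) (A : I -> set T) :
  \big[setI/setT]_(i <- s) A i = [set w | forall i, i \in s -> A i w].
Proof. by rewrite -bigcap_seq. Qed.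

(** The finite intersections of events of the merged sigma-algebras form a
    pi-system, on which the finite measures [P (_ `&` B)] and [P B * P _]
    agree; hence they agree on the generated sigma-algebra. *)
Let indep_past (E : set T) (s0 : seq I) (A0 : I -> set T) : uniq s0 ->
  (forall i, i \in s0 -> ~~ I1 i /\ F i (A0 i)) ->
  <<s \bigcup_(i in [set i | I1 i]) F i >> E ->
  P (E `&` \big[setI/setT]_(i <- s0) A0 i) = (P E * \prod_(i <- s0) P (A0 i))%E.
Proof.
move=> us0 FA0 sE; pose B := \big[setI/setT]_(i <- s0) A0 i.
have mB : measurable B.
  by rewrite /B big_seq; apply: bigsetI_measurable => i /FA0[_]; exact: Fm.
have PB : P B = (\prod_(i <- s0) P (A0 i))%E.
  by rewrite /B (indep_setI FP)// => i /FA0[].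
pose c : {nonneg R} := NngNum (fine_ge0 (measure_ge0 P B)).
have cE : (c%:num%:E = P B)%E by rewrite /= fineK// fin_num_measure.
pose G := [set E | exists s A, [/\ uniq s, forall i, i \in s -> I1 i /\ F i (A i) &
  E = [set w | forall i, i \in s -> A i w]]].
have Gm : G `<=` measurable.
  move=> _ [s [A [us FA ->]]]; rewrite -bigE big_seq; apply: bigsetI_measurable => i /FA[_].
  exact: Fm.
have GT : G setT.
  by exists [::], (fun=> setT); split => //; apply/seteqP; split.
have GI : setI_closed G.
  move=> _ _ [s [A [us FA ->]]] [s' [A' [us' FA' ->]]].
  pose C (t : seq I) (D : I -> set T) i := if i \in t then D i else setT.
  exists (undup (s ++ s')), (fun i => C s A i `&` C s' A' i); split.
  - exact: undup_uniq.
  - move=> i; rewrite mem_undup mem_cat => /orP[] is_; (split; first by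
      [have [] := FA _ is_|have [] := FA' _ is_]); apply: FI; rewrite /C;
      case: ifP => // h; by [have [] := FA _ h|have [] := FA' _ h].
  - apply/seteqP; split => [w [Aw A'w] i _|w CC]; first split; rewrite /C; try by case: ifPn; [move/Aw||move/A'w|].
    split => i is_; have := CC i; rewrite mem_undup mem_cat is_ ?orbT => /(_ isT)[]; rewrite /C is_ //.
have GE : G `<=` <<s G >> by exact: sub_sigma_algebra.
have sGE : <<s G >> E.
  apply: (smallest_sub (smallest_sigma_algebra _ _) _ sE).
  move=> A [i /= I1i FA]; apply: GE; exists [:: i], (fun=> A); split => //.
    by move=> j; rewrite inE => /eqP ->.
  by apply/seteqP; split => [w Aw j _ //|w /(_ i (mem_head _ _))].
pose m1 := mrestr P mB; pose m2 := mscale c P.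
have -> : P (E `&` B) = m1 E by [].
have -> : (P E * \prod_(i <- s0) P (A0 i))%E = m2 E.
  by rewrite /m2 /mscale cE PB muleC.
apply: (@g_sigma_algebra_measure_unique _ _ _ G Gm (fun=> setT)) => //.
- by apply/seteqP; split => // w _; exists 0%N.
- move=> X [s [A [us FA XE]]]; suff: m1 X = m2 X by [].
  rewrite /m1 /m2 /mrestr /mscale cE PB XE -bigE.
  pose D i := if i \in s then A i else A0 i.
  have s0s i : i \in s0 -> i \in s = false.
    by move=> /FA0[nI _]; apply/negP => /FA[h _]; rewrite h in nI.
  have D1 (V : Type) (op : V -> V -> V) (x : V) (g : set T -> V) :
      \big[op/x]_(j <- s) g (A j) = \big[op/x]_(j <- s) g (D j).
    by apply: eq_big_seq => j js; rewrite /D js.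
  have D2 (V : Type) (op : V -> V -> V) (x : V) (g : set T -> V) :
      \big[op/x]_(j <- s0) g (A0 j) = \big[op/x]_(j <- s0) g (D j).
    by apply: eq_big_seq => j js; rewrite /D s0s.
  have FD i : i \in s ++ s0 -> F i (D i).
    rewrite mem_cat /D => /orP[is_|is_].
      by rewrite is_; have [] := FA _ is_.
    by rewrite s0s//; have [] := FA0 _ is_.
  rewrite /B (D1 _ _ _ id) (D2 _ _ _ id)/= -big_cat/= (indep_setI FP)//.
    rewrite big_cat/= muleC -(D2 _ _ _ P); congr (_ * _)%E.
    by rewrite (indep_setI FP)// => i is_; apply: FD; rewrite mem_cat is_.
  rewrite cat_uniq us us0 andbT/=; apply/hasPn => i /s0s /=.
  by move=> ->.
- by move=> _; rewrite /m1 /mrestr (le_lt_trans (probability_le1 _ _)) ?ltry//; exact: measurableI.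
Qed.

Lemma mutually_independent_grouped : mutually_independent P grouped.
Proof.
apply: mutually_independent_seq => s A us FA.
pose s0 := pmap id s.
have us0 : uniq s0 by apply: pmap_uniq us => -[].
have ms0 j : (j \in s0) = (Some j \in s) by rewrite mem_pmap map_id.
have FA0 j : j \in s0 -> ~~ I1 j /\ F j (A (Some j)) by rewrite ms0 => /FA.
have [Ns|Ns] := boolP (None \in s).
  have ps : perm_eq s (None :: map Some s0).
    apply: uniq_perm => //=.
      rewrite map_inj_uniq ?us0 ?andbT; last by move=> ? ? [].
      by apply/mapP => -[].
    move=> [j|]; rewrite inE ?Ns//= mem_map; last by move=> ? ? [].
    by rewrite ms0.
  rewrite !(perm_big _ ps)/= !big_cons !big_map.
  by apply: indep_past => //; exact: (FA None Ns).
have ps : perm_eq s (map Some s0).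
  apply: uniq_perm => //=.
    by rewrite map_inj_uniq; last by move=> ? ? [].
  move=> [j|]; last by rewrite (negbTE Ns); apply/esym/mapP => -[].
  by rewrite mem_map ?ms0//; move=> ? ? [].
rewrite !(perm_big _ ps)/= !big_map.
by rewrite (indep_setI FP)// => i /FA0[].
Qed.

End Grouping.

(** * The generating function of the INAR(1) process *)

Section CountableSplitting.
Context d (T : measurableType d) (R : realType) (P : probability T R).

Lemma measurable_level (N : T -> nat) x :
  measurable_fun setT N -> measurable (N @^-1` [set x]).
Proof. by move=> mN; rewrite -[_ @^-1` _]setTI; exact: mN. Qed.

Lemma integral_level_sets (N : T -> nat) (g : T -> R) :
  measurable_fun setT N -> measurable_fun setT g -> (forall w, 0 <= g w) ->
  (\int[P]_w (g w)%:E =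
   \sum_(x <oo) \int[P]_w (g w * \1_(N @^-1` [set x]) w)%:E)%E.
Proof.
move=> mN mg g0; pose F x := N @^-1` [set x].
have FT : \bigcup_x F x = setT.
  by apply/seteqP; split => // w _; exists (N w).
rewrite -{1}FT ge0_integral_bigcup//.
- apply: eq_eseriesr => x _; rewrite integral_mkcond; apply: eq_integral => w _.
  rewrite /patch indicE; case: ifPn => h; first by rewrite mulr1.
  by rewrite mulr0.
- by move=> x; exact: measurable_level.
- by apply/measurable_EFinP; rewrite FT.
- by move=> w _; rewrite lee_fin.
- by move=> i j _ _ [w [/= <- <-]].
Qed.

Lemma measurable_fun_nat_comp d' (U : measurableType d') (N : T -> nat)
    (f : nat -> T -> U) : measurable_fun setT N ->
  (forall x, measurable_fun setT (f x)) ->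
  measurable_fun setT (fun w => f (N w) w).
Proof.
move=> mN mf _ B mB; rewrite setTI.
have -> : (fun w => f (N w) w) @^-1` B =
    \bigcup_x (N @^-1` [set x] `&` f x @^-1` B).
  apply/seteqP; split => [w Bw|w [x _ [/= <- //]]].
  by exists (N w).
apply: bigcupT_measurable => x; apply: measurableI; first exact: measurable_level.
by rewrite -[_ @^-1` _]setTI; exact: mf.
Qed.

Lemma poisson_pgf (X : T -> nat) (rate z : R) : measurable_fun setT X ->
  0 < rate -> 0 <= z -> has_law P X (poisson_prob rate 0%N) ->
  (\int[P]_w (z ^+ X w)%:E = (expR (rate * (z - 1)))%:E)%E.
Proof.
move=> mX rate0 z0 lX.
have mz : measurable_fun setT (fun w => z ^+ X w).
  by apply: (@measurableT_comp _ _ _ _ _ _ (fun k : nat => z ^+ k)).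
rewrite (integral_level_sets mX mz); last by move=> w; rewrite exprn_ge0.
transitivity (\sum_(x <oo) ((expR (- rate))%:E * (exp_coeff (rate * z) x)%:E))%E.
  apply: eq_eseriesr => x _.
  under eq_integral => w _.
    have -> : z ^+ X w * \1_(X @^-1` [set x]) w = z ^+ x * \1_(X @^-1` [set x]) w :> R.
      by rewrite indicE; case: (boolP (_ \in _)) => [|_]; rewrite ?mulr0// inE/= => ->.
    rewrite EFinM; over.
  rewrite ge0_integralZl_EFin ?exprn_ge0//; last first.
    by apply/measurable_EFinP; apply: measurable_indic; exact: measurable_level.
  rewrite integral_indic//; last exact: measurable_level.
  rewrite setIT [X in (_ * X)%E](lX [set x])// /poisson_prob rate0 esum_set1 ?lee_fin ?poisson_pmf_ge0//.
  by rewrite /poisson_pmf rate0 -!EFinM /exp_coeff/= exprMn; congr EFin; ring.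
rewrite nneseriesZl; last by move=> x _; rewrite lee_fin /exp_coeff/= divr_ge0 ?exprn_ge0 ?mulr_ge0 ?(ltW rate0).
have -> : (\sum_(x <oo) (exp_coeff (rate * z) x)%:E = (expR (rate * z))%:E)%E.
  rewrite -EFin_lim; last exact: is_cvg_series_exp_coeff.
  by apply/congr_lim/funext => n /=; rewrite -sumEFin.
by rewrite -EFinM -expRD; congr (expR _)%:E; ring.
Qed.

Lemma bernoulli_pgf (X : T -> bool) (p z : R) : measurable_fun setT X ->
  0 <= p <= 1 -> 0 <= z -> has_law P X (bernoulli_prob p) ->
  (\int[P]_w (z ^+ X w)%:E = (1 + p * (z - 1))%:E)%E.
Proof.
move=> mX p01 z0 lX.
transitivity (\int[pushforward P X]_b (z ^+ b)%:E)%E.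
  rewrite ge0_integral_pushforward//.
    by move=> b _; rewrite lee_fin exprn_ge0.
rewrite (eq_measure_integral (bernoulli_prob p)); last by move=> A mA _; exact: lX.
rewrite integral_bernoulli_prob//; last by move=> b; rewrite lee_fin exprn_ge0.
by rewrite -!EFinM -EFinD expr1 expr0 /unstable.onem; congr EFin; ring.
Qed.

End CountableSplitting.

Section InarMgf.
Context (R : realType) (alpha lambda : R).
Hypotheses (alpha01 : 0 < alpha < 1) (lambda0 : 0 < lambda).
Context (d : measure_display) (T : measurableType d) (P : probability T R).
Context (X0 : {RV P >-> nat}) (xi : nat -> nat -> {RV P >-> bool})
  (eps : nat -> {RV P >-> nat}).
Hypotheses (lX0 : has_law P X0 (poisson_prob (lambda / (1 - alpha)) 0%N))
  (lxi : forall k j, has_law P (xi k j) (bernoulli_prob alpha))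
  (leps : forall k, has_law P (eps k) (poisson_prob lambda 0%N))
  (indep : mutually_independent P (innovation_sigma X0 xi eps)).

Let mu := lambda / (1 - alpha).
Let F := innovation_sigma X0 xi eps.
Let Y := inar X0 xi eps.

(** In the generating function of [Y 0, ..., Y n] with argument
    [expR (v k)] at the times [k < n] and [1 + y] at the time [n], thinning
    replaces [1 + y] at the time [n] by [1 + alpha * y] at the time [n - 1].
    By stationarity, [mu] times this sum is the logarithm of the generating
    function, up to the term [mu * y] of [inar_pgf]. *)
Fixpoint inar_exponent (v : nat -> R) (n : nat) (y : R) : R :=
  if n is k.+1 then
    (expR (v k) - 1) * (1 + alpha * y) +
    inar_exponent v k (expR (v k) * (1 + alpha * y) - 1)
  else 0.

Definition past (n : nat) : pred (unit + nat * nat + nat) := fun i =>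
  match i with
  | inl (inl _) => true
  | inl (inr (k, _)) => (k < n)%N
  | inr k => (k < n)%N
  end.

Let preimage_sys d' (U : measurableType d') (f : T -> U) B : measurable B ->
  preimage_set_system setT f measurable (f @^-1` B).
Proof. by move=> mB; exists B => //; rewrite setTI. Qed.

Let Fm i : F i `<=` measurable.
Proof.
have H d' (U : measurableType d') (f : {mfun T >-> U}) :
    preimage_set_system setT f measurable `<=` measurable.
  by move=> _ [B mB <-]; exact: measurable_funP.
by case: i => [[?|[k j]]|k]; exact: H.
Qed.

Let FT i : F i setT.
Proof. by case: i => [[?|[k j]]|k]; (exists setT; [exact: measurableT|rewrite setTI]). Qed.

Let FI i : setI_closed (F i).
Proof.
by case: i => [[?|[k j]]|k] _ _ [B mB <-] [C mC <-];
  (exists (B `&` C); [exact: measurableI|rewrite !setTI]).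
Qed.

Notation pastType n := (g_sigma_algebraType (\bigcup_(i in [set i | past n i]) F i)).

Let past_measurable n i (B : set T) : past n i -> F i B ->
  measurable (B : set (pastType n)).
Proof. by move=> ni FB; apply: sub_sigma_algebra; exists i. Qed.

Lemma measurable_inar_past n k : (k <= n)%N ->
  measurable_fun setT (Y k : pastType n -> nat).
Proof.
elim: k => [_|k IH kn].
  move=> _ B mB; rewrite setTI; apply: (@past_measurable n (inl (inl tt))) => //.
  exact: preimage_sys.
rewrite /Y/=; apply: measurable_fun_addn; last first.
  move=> _ B mB; rewrite setTI; apply: (@past_measurable n (inr k)) => //.
  exact: preimage_sys.
apply: (@measurable_fun_nat_comp _ (pastType n) _ _ (Y k)
  (fun x w => (\sum_(j < x) (xi k j w : nat))%N)); first exact: IH (ltnW kn).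
elim=> [|x IHx].
  rewrite [X in measurable_fun _ X](_ : _ = cst 0%N); first exact: measurable_cst.
  by apply/funext => w; rewrite big_ord0.
rewrite [X in measurable_fun _ X](_ : _ =
    (fun w => (\sum_(j < x) (xi k j w : nat) + (xi k x w : nat))%N)); last first.
  by apply/funext => w; rewrite big_ord_recr.
apply: measurable_fun_addn => //.
apply: (@measurableT_comp _ _ _ _ _ _ nat_of_bool) => //.
move=> _ B mB; rewrite setTI; apply: (@past_measurable n (inl (inr (k, x : nat)))) => //.
exact: preimage_sys.
Qed.

Lemma past_sub n : <<s \bigcup_(i in [set i | past n i]) F i >> `<=` measurable.
Proof.
apply: smallest_sub; first exact: sigma_algebra_measurable.
by move=> A [i _]; exact: Fm.
Qed.

Lemma measurable_inar k : measurable_fun setT (Y k : T -> nat).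
Proof.
by move=> _ B mB; apply: (@past_sub k); exact: (@measurable_inar_past k k).
Qed.

Let past_measurable_fun n d' (U : measurableType d') (f : T -> U) :
  measurable_fun setT (f : pastType n -> U) -> measurable_fun setT f.
Proof. by move=> mf _ B mB; apply: (@past_sub n); exact: mf. Qed.

Definition path_exp (v : nat -> R) n w : R := \prod_(k < n) expR (v k * (Y k w)%:R).

Lemma path_exp_ge0 v n w : 0 <= path_exp v n w.
Proof. by apply: prodr_ge0 => k _; exact: expR_ge0. Qed.

Lemma path_expS v n w : path_exp v n.+1 w = path_exp v n w * expR (v n) ^+ Y n w.
Proof. by rewrite /path_exp big_ord_recr/= -expRM_natr. Qed.

Let measurable_natr d' (T' : measurableType d') (N : T' -> nat) :
  measurable_fun setT N -> measurable_fun setT (fun w => (N w)%:R : R).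
Proof. by move=> mN; apply: (@measurableT_comp _ _ _ _ _ _ (fun k : nat => k%:R : R)). Qed.

Lemma measurable_path_exp_past v n :
  measurable_fun setT (path_exp v n.+1 : pastType n -> R).
Proof.
apply: measurable_prod => k _; apply: measurableT_comp => //.
apply: measurable_funM => //; apply: measurable_natr.
by apply: measurable_inar_past; rewrite -ltnS.
Qed.

Lemma measurable_path_exp v n : measurable_fun setT (path_exp v n.+1 : T -> R).
Proof. by apply: (@past_measurable_fun n); exact: measurable_path_exp_past. Qed.

Let measurable_pow d' (T' : measurableType d') (N : T' -> nat) (z : R) :
  measurable_fun setT N -> measurable_fun setT (fun w => z ^+ N w).
Proof. by move=> mN; apply: (@measurableT_comp _ _ _ _ _ _ (fun k : nat => z ^+ k)). Qed.

(** On the event [Y n = x] the variable [Y n.+1] is a sum of [x] Bernoulli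
    variables and a Poisson one, independent of each other and of the past. *)
Lemma inar_pgf_on_level v n (z : R) x : 0 < z ->
  (\int[P]_w (path_exp v n.+1 w)%:E < +oo)%E ->
  (\int[P]_w (path_exp v n.+1 w * z ^+ Y n.+1 w * \1_(Y n @^-1` [set x]) w)%:E =
   (expR (lambda * (z - 1)))%:E *
   \int[P]_w (path_exp v n.+1 w * (1 + alpha * (z - 1)) ^+ Y n w *
      \1_(Y n @^-1` [set x]) w)%:E)%E.
Proof.
move=> z0 finE; have zge0 := ltW z0.
pose G w := path_exp v n.+1 w * \1_(Y n @^-1` [set x]) w.
have mlev : measurable (Y n @^-1` [set x] : set T).
  by apply: measurable_level; exact: measurable_inar.
have G0 w : 0 <= G w by rewrite /G mulr_ge0 ?path_exp_ge0.
have mG : measurable_fun setT (G : pastType n -> R).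
  apply: measurable_funM; first exact: measurable_path_exp_past.
  by apply: measurable_indic; apply: measurable_level; exact: measurable_inar_past.
have mGT := past_measurable_fun mG.
have finG : (\int[P]_w (G w)%:E)%E \is a fin_num.
  rewrite ge0_fin_numE; last by apply: integral_ge0 => w _; rewrite lee_fin.
  apply: le_lt_trans finE; apply: ge0_le_integral => //.
  - by move=> w _; rewrite lee_fin.
  - by apply/measurable_EFinP.
  - by apply/measurable_EFinP; exact: measurable_path_exp.
  - by move=> w _; rewrite lee_fin ler_piMr ?path_exp_ge0// indicE; case: (_ \in _).
pose q := 1 + alpha * (z - 1).
pose Yo (o : option (unit + nat * nat + nat)) w : R := match o with
  | None => G w
  | Some (inl (inl _)) => 1
  | Some (inl (inr (k, j))) => z ^+ xi k j w
  | Some (inr k) => z ^+ eps k w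
  end.
pose eo (o : option (unit + nat * nat + nat)) : R := match o with
  | None => fine (\int[P]_w (G w)%:E)%E
  | Some (inl (inl _)) => 1
  | Some (inl (inr (k, j))) => q
  | Some (inr k) => expR (lambda * (z - 1))
  end.
pose s : seq (option (unit + nat * nat + nat)) :=
  None :: Some (inr n) :: [seq Some (inl (inr (n, j))) | j <- iota 0 x].
have us : uniq s.
  rewrite /= inE/= map_inj_uniq ?iota_uniq ?andbT; last by move=> ? ? [].
  by apply/andP; split; apply/mapP => -[].
have prodE (V : option (unit + nat * nat + nat) -> R) : \prod_(o <- s) V o =
    V None * (V (Some (inr n)) * \prod_(j < x) V (Some (inl (inr (n, j : nat))))).
  have iE : iota 0 x = index_iota 0 x by rewrite /index_iota subn0.
  by rewrite /s !big_cons big_map iE big_mkord.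
transitivity (\int[P]_w (\prod_(o <- s) Yo o w)%:E)%E.
  apply: eq_integral => w _; rewrite prodE /= /G; congr EFin.
  rewrite -[in LHS]mulrA -[in RHS]mulrA; congr (_ * _).
  rewrite indicE; case: (boolP (_ \in _)) => [|_]; last by rewrite mulr0 mul0r.
  rewrite inE/= => Yx; rewrite mulr1 mul1r /Y/= -/Y Yx exprD mulrC; congr (_ * _).
  exact: expr_sum.
rewrite (@indep_integral_prod _ _ _ _ _ (grouped F (past n)) _ _ Yo eo)//.
- rewrite prodE/= prodr_const card_ord EFinM fineK//.
  under [in RHS]eq_integral => w _.
    have -> : path_exp v n.+1 w * (1 + alpha * (z - 1)) ^+ Y n w *
        \1_(Y n @^-1` [set x]) w = q ^+ x * G w.
      rewrite /G; rewrite indicE; case: (boolP (_ \in _)) => [|_]; last by rewrite !mulr0.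
      by rewrite inE/= => ->; rewrite !mulr1 mulrC.
    rewrite EFinM; over.
  have /andP[a0 a1] := alpha01; have q0 : 0 <= q by rewrite /q; nra.
  rewrite ge0_integralZl_EFin ?exprn_ge0//; last 2 first.
  + by move=> w _; rewrite lee_fin.
  + by apply/measurable_EFinP.
  by rewrite [LHS]muleC muleA -EFinM.
- move=> [j|] A //=; first by move=> [_]; exact: Fm.
  exact: past_sub.
- exact: mutually_independent_grouped.
- by move=> [[[?|[k j]]|k]|] w _ //=; rewrite ?exprn_ge0.
- move=> o B; rewrite /s !inE => /or3P[/eqP ->|/eqP ->|/mapP[j _ ->]] mB.
  + by rewrite /= -[_ @^-1` _]setTI; exact: mG.
  + rewrite /=; split; first by rewrite ltnn.
    by exists ((fun k : nat => z ^+ k) @^-1` B) => //; rewrite setTI.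
  + rewrite /=; split; first by rewrite ltnn.
    by exists ((fun k : bool => z ^+ k) @^-1` B) => //; rewrite setTI.
- move=> [[[?|[k j]]|k]|] _ /=.
  + by rewrite integral_cst// mul1e; exact: probability_setT.
  + by have /andP[a0 a1] := alpha01; apply: bernoulli_pgf; rewrite ?(ltW a0) ?(ltW a1).
  + exact: poisson_pgf.
  + by rewrite fineK.
Qed.

(** Summing [inar_pgf_on_level] over the values of [Y n] removes the time
    [n.+1]. The exponents combine because of [lambda = mu * (1 - alpha)], which
    is the stationarity of the Poisson law of rate [mu]. *)
Lemma inar_pgf v n (z : R) : 0 < z ->
  (\int[P]_w (path_exp v n w * z ^+ Y n w)%:E =
   (expR (mu * (z - 1 + inar_exponent v n (z - 1))))%:E)%E.
Proof.
have /andP[a0 a1] := alpha01.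
have mu0 : 0 < mu by rewrite divr_gt0// subr_gt0.
elim: n z => [|n IH] z z0.
  rewrite /= addr0 -(@poisson_pgf _ _ _ P X0) ?(ltW z0)//.
  by apply: eq_integral => w _; rewrite /path_exp big_ord0 mul1r.
have zge0 := ltW z0; pose q := 1 + alpha * (z - 1).
have q0 : 0 < q by rewrite /q; nra.
have finE : (\int[P]_w (path_exp v n.+1 w)%:E < +oo)%E.
  under eq_integral do rewrite path_expS.
  by rewrite IH ?expR_gt0// ltry.
have mE := measurable_path_exp v n.
have mpow k (c : R) : measurable_fun setT (fun w : T => c ^+ Y k w).
  by apply: measurable_pow; exact: measurable_inar.
rewrite (@integral_level_sets _ _ _ _ (Y n)); last 3 first.
- exact: measurable_inar.
- exact: measurable_funM.
- by move=> w; rewrite mulr_ge0 ?path_exp_ge0 ?exprn_ge0.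
under eq_eseriesr do rewrite inar_pgf_on_level//.
rewrite nneseriesZl; last first.
  move=> x _; apply: integral_ge0 => w _.
  by rewrite lee_fin !mulr_ge0 ?path_exp_ge0 ?exprn_ge0 ?(ltW q0).
rewrite -(@integral_level_sets _ _ _ _ (Y n)
  (fun w => path_exp v n.+1 w * q ^+ Y n w)); last 3 first.
- exact: measurable_inar.
- exact: measurable_funM.
- by move=> w; rewrite mulr_ge0 ?path_exp_ge0 ?exprn_ge0 ?(ltW q0).
under eq_integral do rewrite path_expS -mulrA -exprMn.
rewrite IH ?mulr_gt0 ?expR_gt0// -EFinM -expRD /=; congr (expR _)%:E.
have -> : lambda = mu * (1 - alpha) by rewrite /mu divfK// subr_eq0 gt_eqF.
by rewrite /q; ring.
Qed.

Lemma inar_mgf (v : nat -> R) n :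
  (\int[P]_w (expR (\sum_(k < n) v k * (Y k w)%:R))%:E =
   (expR (mu * inar_exponent v n 0))%:E)%E.
Proof.
have := @inar_pgf v n 1 ltr01; rewrite subrr add0r => <-.
by apply: eq_integral => w _; rewrite expr1n mulr1 expR_sum.
Qed.

End InarMgf.

(** * Independent copies *)

Section MeanOfPoissonPgf.
Context d (T : measurableType d) (R : realType) (P : probability T R).

(** Integrating [1 + h * X <= expR (h * X)] shows that
    [h |-> expR (mu * (expR h - 1)) - h * m], with [m] the mean of [X], attains
    its minimum 1 at 0; its derivative there, [mu - m], vanishes. *)
Lemma expectation_of_pgf (X : T -> nat) (mu : R) : measurable_fun setT X ->
  (forall z : R, 0 < z ->
    (\int[P]_w (z ^+ X w)%:E = (expR (mu * (z - 1)))%:E)%E) ->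
  fine ('E_P[(fun w => (X w)%:R : R)])%E = mu.
Proof.
move=> mX pgf.
have mXR : measurable_fun setT (fun w => (X w)%:R : R).
  by apply: (@measurableT_comp _ _ _ _ _ _ (fun k : nat => k%:R : R)).
have iexp (h : R) : P.-integrable setT (EFin \o (fun w => expR h ^+ X w)).
  apply/integrableP; split.
    by apply/measurable_EFinP; apply: (@measurableT_comp _ _ _ _ _ _ (fun k : nat => expR h ^+ k)).
  under eq_integral do rewrite /= ger0_norm ?exprn_ge0 ?expR_ge0//.
  by rewrite pgf ?expR_gt0// ltry.
have iX : P.-integrable setT (EFin \o (fun w => (X w)%:R : R)).
  apply: le_integrable (iexp 1) => //; first exact/measurable_EFinP.
  move=> w _; rewrite /= lee_fin !ger0_norm ?exprn_ge0 ?expR_ge0//.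
  by rewrite -expRM_natr mul1r (le_trans _ (expR_ge1Dx _))// lerDr.
pose m := \int[P]_w ((X w)%:R : R).
have -> : fine ('E_P[(fun w => (X w)%:R : R)])%E = m by rewrite unlock.
have tangent (h : R) : 1 + h * m <= expR (mu * (expR h - 1)).
  have i1 : P.-integrable setT (EFin \o (fun=> 1 : R)) by exact: finite_measure_integrable_cst.
  have ihX : P.-integrable setT (EFin \o (fun w => h * (X w)%:R)).
    by apply: eq_integrable (integrableZl measurableT h iX).
  have i1hX : P.-integrable setT (EFin \o (fun w => 1 + h * (X w)%:R)).
    by apply: eq_integrable (integrableD measurableT i1 ihX).
  have -> : expR (mu * (expR h - 1)) = \int[P]_w (expR h ^+ X w).
    by rewrite /Rintegral pgf ?expR_gt0.
  have -> : 1 + h * m = \int[P]_w (1 + h * (X w)%:R).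
    rewrite RintegralD// RintegralZl// Rintegral_cst//.
    by rewrite [X in fine X](@probability_setT _ _ _ P) mulr1.
  apply: le_Rintegral => // w _.
  by rewrite -expRM_natr expR_ge1Dx.
pose f h := expR (mu * (expR h - 1)) - h * m.
have df (h : R) : is_derive h 1 f (expR (mu * (expR h - 1)) * (mu * expR h) - m).
  rewrite /f; apply: is_derive_eq.
  rewrite !(scaler0, mulr0, addr0, add0r, subr0, scaler1, mulr1) /GRing.scale/=.
  by [].
have : is_derive (0 : R) 1 f 0.
  apply: (@derive1_at_min R f (-1) 1 0).
  - by rewrite (le_trans (lerN10 _))// ler01.
  - by move=> t _; exact: ex_derive.
  - by rewrite in_itv/= ltrN10 ltr01.
  - move=> t _; rewrite /f mul0r subr0 expR0 subrr mulr0 expR0.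
    by rewrite lerBrDr tangent.
move/@derive_val; rewrite derive_val expR0 subrr mulr0 expR0 !mul1r mulr1.
by move/eqP; rewrite subr_eq0 => /eqP.
Qed.

End MeanOfPoissonPgf.

Section Copies.
Context (R : realType) (d0 : measure_display) (T0 : measurableType d0)
  (P0 : probability T0 R) (Y : nat -> T0 -> nat).
Context (d : measure_display) (T : measurableType d) (P : probability T R)
  (X : nat -> nat -> T -> nat).
Hypotheses (mY : forall k, measurable_fun setT (Y k))
  (mX : forall j k, measurable_fun setT (X j k))
  (hX : independent_copies P0 Y P X).

Notation pathType := (g_sigma_algebraType (\bigcup_k preimage_set_system setT
  (fun x : nat -> nat => x k) (@measurable _ nat))).

Lemma measurable_coordinate k :
  measurable_fun setT ((fun x => x k) : pathType -> nat).
Proof.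
move=> _ B mB; apply: sub_sigma_algebra; exists k => //.
by exists B.
Qed.

Lemma measurable_trajectory d' (T' : measurableType d') (Z : nat -> T' -> nat) :
  (forall k, measurable_fun setT (Z k)) ->
  measurable_fun setT (trajectory Z : T' -> pathType).
Proof.
move=> mZ; apply: (@measurability _ _ _ pathType _ _ (\bigcup_k preimage_set_system setT
  (fun x : nat -> nat => x k) (@measurable _ nat))) => //.
move=> _ [_ [k _ [B mB <-]] <-]; rewrite !setTI.
by rewrite -[X in measurable X]setTI; exact: mZ.
Qed.

Lemma integral_copy j (H : pathType -> \bar R) : measurable_fun setT H ->
  (forall x, (0 <= H x)%E) ->
  (\int[P]_w H (trajectory (X j) w) = \int[P0]_w H (trajectory Y w))%E.
Proof.
move=> mH H0.
have mtX := measurable_trajectory (mX j); have mtY := measurable_trajectory mY.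
transitivity (\int[pushforward P (trajectory (X j) : T -> pathType)]_x H x)%E.
  by rewrite ge0_integral_pushforward.
rewrite (eq_measure_integral (pushforward P0 (trajectory Y : T0 -> pathType))).
  by rewrite ge0_integral_pushforward.
by move=> A mA _; apply: (hX.1 j).
Qed.

Lemma copies_mgf (v : nat -> R) n N (M : R) :
  (\int[P0]_w (expR (\sum_(k < n) v k * (Y k w)%:R))%:E = M%:E)%E ->
  (\int[P]_w (expR (\sum_(j < N) \sum_(k < n) v k * (X j k w)%:R))%:E =
   (M ^+ N)%:E)%E.
Proof.
move=> YM.
pose H (x : pathType) := expR (\sum_(k < n) v k * (x k)%:R).
have mH : measurable_fun setT H.
  apply: measurableT_comp => //; apply: measurable_sum => k.
  apply: measurable_funM => //.
  apply: (@measurableT_comp _ _ _ _ _ _ (fun k : nat => k%:R : R)) => //.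
  exact: measurable_coordinate.
have XM j : (\int[P]_w (H (trajectory (X j) w))%:E = M%:E)%E.
  rewrite (integral_copy j (H := EFin \o H))//; first exact/measurable_EFinP.
  by move=> x; rewrite lee_fin expR_ge0.
have := @indep_integral_prod _ _ _ P _
  (fun j => preimage_set_system setT (trajectory (X j)) path_measurable) _ hX.2
  (fun j w => H (trajectory (X j) w)) (fun=> M) (index_iota 0 N).
rewrite prodr_const_nat subn0 => <-.
- by apply: eq_integral => w _; rewrite big_mkord expR_sum.
- move=> j _ [A mA <-]; exact: (measurable_trajectory (mX j)).
- exact: iota_uniq.
- by move=> *; exact: expR_ge0.
- move=> j B _ mB; exists (H @^-1` B); last by rewrite setTI.
  by rewrite -[H @^-1` B]setTI; exact: mH.
- by move=> j _; exact: XM.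
Qed.

End Copies.

(** * Second-order expansion of the exponent *)

Section Expansion.
Variables (R : realType) (alpha : R).
Hypothesis alpha01 : 0 < alpha < 1.

(** Only the order in [b] matters; 4 is a convenient upper bound of [expR 1]. *)
Lemma expR_taylor (b x : R) K : 0 < b <= 1 -> `|x| <= b ->
  `|expR x - series (exp_coeff x) K| <= 4 * b ^+ K.
Proof.
move=> /andP[b0 b1] xb.
have := @expR_tail_le R b^-1 x K _; rewrite invf_ge1// => /(_ b1) h.
apply: le_trans h _; rewrite -exprVn invrK mulrC ler_wpM2r ?exprn_ge0 ?(ltW b0)//.
have bx : b^-1 * `|x| <= 1 by rewrite mulrC ler_pdivrMr// mul1r.
apply: le_trans (_ : expR 1 <= 4); first by rewrite ler_expR.
have h2 : expR (2^-1 : R) <= 2.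
  rewrite -[expR _]invrK -expRN -[leRHS]invrK lef_pV2 ?posrE ?invr_gt0 ?expR_gt0//.
  by have := expR_ge1Dx (- 2^-1 : R); lra.
have -> : expR 1 = expR 2^-1 * expR 2^-1 :> R by rewrite -expRD; congr expR; lra.
by have := expR_gt0 (2^-1 : R); nra.
Qed.

(** The recursion of [inar_exponent] truncated at the second order in [v], with
    [a] standing for the first-order part of [y]. *)
Fixpoint quadratic_exponent (v : nat -> R) (n : nat) (a : R) : R :=
  if n is k.+1 then
    v k + v k ^+ 2 / 2 + alpha * v k * a + quadratic_exponent v k (v k + alpha * a)
  else 0.

(** The bilinear form of the covariances [alpha ^+ `|k - l|] of a stationary
    autoregression of unit variance. In truncated subtraction the absolute
    difference is [(k - l) + (l - k)]. *)
Definition ar1_form (n : nat) (v w : nat -> R) : R :=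
  \sum_(k < n) \sum_(l < n) v k * w l * alpha ^+ (k - l + (l - k))%N.

Lemma quadratic_exponentE v n a : quadratic_exponent v n a =
  \sum_(k < n) v k + ar1_form n v v / 2 + \sum_(k < n) v k * alpha ^+ (n - k)%N * a.
Proof.
elim: n a => [|n IH] a /=; first by rewrite /ar1_form !big_ord0; ring.
have sumS : \sum_(k < n.+1) v k * alpha ^+ (n.+1 - k)%N * a =
    alpha * (\sum_(k < n) v k * alpha ^+ (n - k)%N * a) + v n * alpha * a.
  rewrite big_ord_recr/= subSnn expr1; congr (_ + _).
  by rewrite mulr_sumr; apply: eq_bigr => k _; rewrite subSn ?(ltnW (ltn_ord k))// exprS; ring.
have formS : ar1_form n.+1 v v =
    ar1_form n v v + 2 * v n * (\sum_(k < n) v k * alpha ^+ (n - k)%N) + v n ^+ 2.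
  rewrite /ar1_form big_ord_recr/=.
  under eq_bigr do rewrite big_ord_recr/=.
  rewrite big_split/= big_ord_recr/= subnn expr0 mulr1.
  have -> : \sum_(i < n) v i * v n * alpha ^+ (i - n + (n - i))%N =
      v n * \sum_(k < n) v k * alpha ^+ (n - k)%N.
    rewrite mulr_sumr; apply: eq_bigr => k _.
    have /eqP -> : (k - n == 0)%N by rewrite subn_eq0 ltnW.
    by rewrite add0n; ring.
  have -> : \sum_(i < n) v n * v i * alpha ^+ (n - i + (i - n))%N =
      v n * \sum_(k < n) v k * alpha ^+ (n - k)%N.
    rewrite mulr_sumr; apply: eq_bigr => k _.
    have /eqP -> : (k - n == 0)%N by rewrite subn_eq0 ltnW.
    by rewrite addn0; ring.
  ring.
rewrite IH sumS formS big_ord_recr/= -!mulr_suml.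
by field.
Qed.

(** Along the recursion [y] stays of order [b] and [y - a] of order [b ^+ 2];
    the constants [K] and [K'] are the fixed points of the corresponding
    affine recursions of ratio [alpha]. Each step then costs [O(b ^+ 3)]. *)
Lemma inar_exponent_dist (v : nat -> R) (b : R) n : 0 < b -> b <= (1 - alpha) / 8 ->
  (forall k, `|v k| <= b) ->
  let K := 8 / (1 - alpha) in let K' := (4 + 4 * K) / (1 - alpha) in
  forall y a, `|y| <= K * b -> `|y - a| <= K' * b ^+ 2 ->
  `|inar_exponent alpha v n y - quadratic_exponent v n a| <=
  n%:R * ((4 + 4 * K + K') * b ^+ 3).
Proof.
move=> b0 b6 vb K K'; have /andP[a0 a1] := alpha01.
have a'0 : 0 < 1 - alpha by rewrite subr_gt0.
have Kb : K * b <= 1.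
  by rewrite /K mulrAC ler_pdivrMr// mul1r mulrC -ler_pdivlMr.
have K0 : 0 < K by rewrite divr_gt0.
have KE : K = 8 + alpha * K by rewrite /K; field; rewrite gt_eqF.
have K'0 : 0 < K' by rewrite divr_gt0// addr_gt0// mulr_gt0.
have K'E : K' = 4 + 4 * K + alpha * K' by rewrite /K'; field; rewrite gt_eqF.
have b1 : b <= 1 by lra.
elim: n => [|n IH] y a yb ya /=; first by rewrite subrr normr0 mul0r.
have b01 : 0 < b <= 1 by rewrite b0.
have e1 := expR_taylor 1 b01 (vb n); have e2 := expR_taylor 2 b01 (vb n).
have e3 := expR_taylor 3 b01 (vb n).
move: e1 e2 e3; rewrite /series/= !big_nat_recr//= !big_geq// /exp_coeff/=.
rewrite !expr0 !expr1 !divr1 !add0r; set E := expR (v n) => e1 e2 e3.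
have vbn := vb n.
have aab (c d p q : R) : 0 <= p -> `|c| <= p -> `|d| <= q -> `|c * d| <= p * q.
  by move=> p0 cp dq; rewrite normrM ler_pM.
have ay : `|alpha * y| <= alpha * (K * b) by rewrite normrM gtr0_norm// ler_pM2l.
have aya : `|alpha * (y - a)| <= alpha * (K' * b ^+ 2).
  by rewrite normrM gtr0_norm// ler_pM2l.
have bK0 : 0 <= K * b by rewrite mulr_ge0 ?ltW.
have H1 : `|E * (1 + alpha * y) - 1| <= K * b.
  have -> : E * (1 + alpha * y) - 1 = (E - 1) + (E - 1) * (alpha * y) + alpha * y by ring.
  have h := aab _ _ _ _ _ e1 ay.
  apply: le_trans (ler_normD _ _) _.
  apply: le_trans (lerD (ler_normD _ _) (lexx _)) _.
  have := h (mulr_ge0 (ler0n _ 4) (ltW b0)).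
  have : 4 * b * (alpha * (K * b)) <= 4 * b.
    by rewrite ler_piMr ?mulr_ge0 ?(ltW b0)//; nra.
  have : 4 * b + 4 * b + alpha * (K * b) = K * b by rewrite {2}KE; ring.
  lra.
have H2 : `|E * (1 + alpha * y) - 1 - (v n + alpha * a)| <= K' * b ^+ 2.
  have -> : E * (1 + alpha * y) - 1 - (v n + alpha * a) =
    (E - (1 + v n)) + (E - 1) * (alpha * y) + alpha * (y - a) by ring.
  have h := aab _ _ _ _ (mulr_ge0 (ler0n _ 4) (ltW b0)) e1 ay.
  apply: le_trans (ler_normD _ _) _.
  apply: le_trans (lerD (ler_normD _ _) (lexx _)) _.
  have : 4 * b * (alpha * (K * b)) <= 4 * K * b ^+ 2.
    have : 0 <= K * b * b by rewrite mulr_ge0// ltW.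
    nra.
  have : 4 * b ^+ 2 + 4 * K * b ^+ 2 + alpha * (K' * b ^+ 2) = K' * b ^+ 2.
    by rewrite {2}K'E; ring.
  lra.
have H3 : `|(E - 1) * (1 + alpha * y) - (v n + v n ^+ 2 / 2 + alpha * v n * a)| <=
    (4 + 4 * K + K') * b ^+ 3.
  have -> : (E - 1) * (1 + alpha * y) - (v n + v n ^+ 2 / 2 + alpha * v n * a) =
    (E - (1 + v n + v n ^+ 2 / 2)) + (E - (1 + v n)) * (alpha * y) +
    v n * (alpha * (y - a)) by field.
  have h1 := aab _ _ _ _ (mulr_ge0 (ler0n _ 4) (exprn_ge0 2 (ltW b0))) e2 ay.
  have h2 := aab _ _ _ _ (ltW b0) vbn aya.
  apply: le_trans (ler_normD _ _) _.
  apply: le_trans (lerD (ler_normD _ _) (lexx _)) _.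
  have : 4 * b ^+ 2 * (alpha * (K * b)) <= 4 * K * b ^+ 3.
    have : 0 <= K * b ^+ 3 by rewrite mulr_ge0 ?exprn_ge0 ?ltW.
    nra.
  have : b * (alpha * (K' * b ^+ 2)) <= K' * b ^+ 3.
    have : 0 <= K' * b ^+ 3 by rewrite mulr_ge0 ?exprn_ge0 ?ltW.
    nra.
  lra.
have := IH _ _ H1 H2; rewrite -[n.+1%:R]natr1 (mulrDl n%:R) mul1r.
set r1 := inar_exponent _ _ _ _; set r2 := quadratic_exponent _ _ _ => H4.
rewrite addrC opprD addrACA [leLHS](_ : _ = `|(r1 - r2) + ((E - 1) * (1 + alpha * y) -
  (v n + v n ^+ 2 / 2 + alpha * v n * a))|); last by congr `|_|; ring.
by rewrite (le_trans (ler_normD _ _))// lerD.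
Qed.

End Expansion.

Section ArForm.
Variables (R : realType) (alpha : R).
Hypothesis alpha01 : 0 < alpha < 1.

Definition upto (p k : nat) : R := ((0 < k)%N && (k <= p)%N)%:R.

Lemma sum_upto p n (G : nat -> R) : (p < n)%N ->
  \sum_(k < n) upto p k * G k = \sum_(1 <= k < p.+1) G k.
Proof.
move=> pn; rewrite -(big_mkord xpredT (fun k => upto p k * G k)).
rewrite (@big_cat_nat _ _ _ p.+1)//= [X in _ + X]big_nat_cond [X in _ + X]big1 ?addr0; last first.
  by move=> k /andP[/andP[pk _] _]; rewrite /upto [(k <= p)%N]leqNgt pk andbF mul0r.
rewrite big_ltn// /upto ltnn mul0r add0r.
by apply: eq_big_nat => k /andP[k0]; rewrite ltnS k0 => ->; rewrite mul1r.
Qed.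

Lemma ar1_formC n v w : ar1_form alpha n v w = ar1_form alpha n w v.
Proof.
rewrite /ar1_form exchange_big; apply: eq_bigr => k _; apply: eq_bigr => l _.
by rewrite addnC [v l * w k]mulrC.
Qed.

Lemma ar1_form_sum m n (u : 'I_m -> R) (w : 'I_m -> nat -> R) :
  ar1_form alpha n (fun k => \sum_i u i * w i k) (fun k => \sum_i u i * w i k) =
  \sum_i \sum_j u i * u j * ar1_form alpha n (w i) (w j).
Proof.
rewrite /ar1_form.
under eq_bigr => k _ do under eq_bigr => l _ do rewrite mulr_suml mulr_suml.
under eq_bigr do rewrite exchange_big.
rewrite exchange_big; apply: eq_bigr => i _.
under eq_bigr => k _ do under eq_bigr => l _ do rewrite mulr_sumr mulr_suml.
under eq_bigr do rewrite exchange_big.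
rewrite exchange_big; apply: eq_bigr => j _.
rewrite mulr_sumr; apply: eq_bigr => k _; rewrite mulr_sumr; apply: eq_bigr => l _.
ring.
Qed.

Lemma ar1_form_upto n p q : (p < n)%N -> (q < n)%N ->
  ar1_form alpha n (upto p) (upto q) =
  \sum_(1 <= k < p.+1) \sum_(1 <= l < q.+1) alpha ^+ (k - l + (l - k))%N.
Proof.
move=> pn qn; rewrite -(@sum_upto p n)//; apply: eq_bigr => k _.
rewrite -(@sum_upto q n)// mulr_sumr; apply: eq_bigr => l _.
by rewrite mulrA.
Qed.

Let cov_row k q := \sum_(1 <= l < q.+1) alpha ^+ (k - l + (l - k))%N.

Let cov_row_diag k : (1 - alpha) * cov_row k k = 1 - alpha ^+ k.
Proof.
elim: k => [|k IH]; first by rewrite /cov_row big_geq// expr0 subrr mulr0.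
have -> : cov_row k.+1 k.+1 = alpha * cov_row k k + 1.
  rewrite /cov_row big_nat_recr//= subnn expr0; congr (_ + _).
  rewrite mulr_sumr; apply: eq_big_nat => l /andP[_ lk].
  rewrite -exprS; congr (_ ^+ _); lia.
by rewrite exprS mulrDr mulr1 mulrCA IH; ring.
Qed.

Let cov_row_ge k r : (1 - alpha) * cov_row k (k + r) = 1 + alpha - alpha ^+ k - alpha ^+ r.+1.
Proof.
elim: r => [|r IH]; first by rewrite addn0 cov_row_diag expr1; ring.
have -> : cov_row k (k + r.+1) = cov_row k (k + r) + alpha ^+ r.+1.
  rewrite /cov_row addnS big_nat_recr//=; congr (_ + _ ^+ _); lia.
by rewrite mulrDr IH [alpha ^+ r.+2]exprS; ring.
Qed.

(** A full two-sided row of covariances sums to [(1 + alpha) / (1 - alpha)]. The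
    parts cut off at the two ends of the window are geometric sums, whose total
    is bounded independently of [p] and [q]. *)
Lemma ar1_form_upto_le n p q : (p <= q)%N -> (q < n)%N ->
  `|ar1_form alpha n (upto p) (upto q) - p%:R * ((1 + alpha) / (1 - alpha))| <=
  2 / (1 - alpha) ^+ 2.
Proof.
move=> pq qn; have /andP[a0 a1] := alpha01.
have a'0 : 0 < 1 - alpha by rewrite subr_gt0.
rewrite (ar1_form_upto (leq_ltn_trans pq qn) qn) -/(cov_row _ _).
have -> : \sum_(1 <= k < p.+1) cov_row k q - p%:R * ((1 + alpha) / (1 - alpha)) =
   - (\sum_(1 <= k < p.+1) (alpha ^+ k + alpha ^+ (q - k).+1) / (1 - alpha)).
  have -> : p%:R * ((1 + alpha) / (1 - alpha)) = \sum_(1 <= k < p.+1) (1 + alpha) / (1 - alpha).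
    by rewrite sumr_const_nat subn1 mulr_natl.
  rewrite -sumrB -sumrN; apply: eq_big_nat => k /andP[_ kp].
  have kq : (k <= q)%N by apply: leq_trans pq.
  have /(congr1 (fun z => z / (1 - alpha))) := cov_row_ge k (q - k).
  rewrite subnKC// mulrAC divff ?gt_eqF// mul1r => ->.
  by field; rewrite gt_eqF.
rewrite normrN ger0_norm; last first.
  apply: sumr_ge0 => k _; apply: divr_ge0; last exact: ltW.
  by rewrite addr_ge0 ?exprn_ge0 ?(ltW a0).
rewrite -mulr_suml big_split/= ler_pdivrMr// expr2 invfM mulrA divfK ?gt_eqF//.
rewrite ler_pdivlMr// mulrC.
have h (r : nat -> nat) : (forall k, (0 < k <= p)%N -> (p - k <= r k)%N) ->
    (1 - alpha) * \sum_(1 <= k < p.+1) alpha ^+ (r k) <= 1.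
  move=> hr; apply: (@le_trans _ _ ((1 - alpha) * cov_row p p)).
    rewrite ler_wpM2l ?(ltW a'0)//; apply: ler_sum_nat => k /andP[k0 kp].
    have kp' : (k <= p)%N by rewrite -ltnS.
    have := hr k; rewrite k0 kp' => /(_ isT) kr.
    rewrite ler_wiXn2l ?(ltW a0) ?(ltW a1)//.
    by have /eqP -> : (k - p == 0)%N by [rewrite subn_eq0]; rewrite addn0.
  by rewrite cov_row_diag gerBl exprn_ge0 ?(ltW a0).
have h0 : (1 - alpha) * \sum_(1 <= k < p.+1) alpha ^+ k <= 1.
  have := cov_row_ge 0 p; rewrite add0n expr0 /cov_row.
  under eq_bigr do rewrite sub0n add0n subn0.
  by move=> ->; have := exprn_ge0 p.+1 (ltW a0); lra.
have h1 := h (fun k => (q - k).+1).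
rewrite mulrDr; have -> : 2 = 1 + 1 :> R by [].
rewrite lerD// h1// => k /andP[_ kp].
by rewrite leqW// leq_sub2r.
Qed.

Lemma ar1_form_upto_dist n p q : (p < n)%N -> (q < n)%N ->
  `|ar1_form alpha n (upto p) (upto q) - (minn p q)%:R * ((1 + alpha) / (1 - alpha))| <=
  2 / (1 - alpha) ^+ 2.
Proof.
move=> pn qn; have [pq|/ltnW qp] := leqP p q.
  exact: ar1_form_upto_le.
by rewrite ar1_formC; exact: ar1_form_upto_le.
Qed.

Lemma cvg_truncn_div (s : R) : 0 <= s ->
  (Num.truncn (n%:R * s))%:R / n%:R @[n --> \oo] --> s.
Proof.
move=> s0; apply: (@squeeze_cvgr _ _ _ _ (fun n => s - n%:R^-1) (fun=> s)).
- near=> n; have n0 : 0 < n%:R :> R by rewrite ltr0n; near: n; exact: nbhs_infty_gt.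
  have := truncn_itv (mulr_ge0 (ler0n R n) s0).
  rewrite -natr1 ler_pdivrMr// ler_pdivlMr// mulrBl mulVf ?gt_eqF// mulrC.
  by move=> /andP[? ?]; apply/andP; split; lra.
- rewrite -[X in _ --> X]subr0; apply: cvgB; first exact: cvg_cst.
  apply/gtr0_cvgV0; last exact: cvgr_idn.
  by near=> n; rewrite ltr0n; near: n; exact: nbhs_infty_gt.
- exact: cvg_cst.
Unshelve. all: by end_near. Qed.

(** The long-run variance of the autoregression. The truncation [N n] only has
    to exceed the two window lengths. *)
Lemma cvg_ar1_form_upto (N : nat -> nat) (s t : R) : 0 <= s -> 0 <= t ->
  (forall n, (Num.truncn (n%:R * s) < N n)%N) ->
  (forall n, (Num.truncn (n%:R * t) < N n)%N) ->
  ar1_form alpha (N n) (upto (Num.truncn (n%:R * s))) (upto (Num.truncn (n%:R * t))) / n%:R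
    @[n --> \oo] --> Num.min s t * ((1 + alpha) / (1 - alpha)).
Proof.
move=> s0 t0 sN tN; set kap := (1 + alpha) / (1 - alpha).
pose D n := ar1_form alpha (N n) (upto (Num.truncn (n%:R * s))) (upto (Num.truncn (n%:R * t))).
have minE n : minn (Num.truncn (n%:R * s)) (Num.truncn (n%:R * t)) =
    Num.truncn (n%:R * Num.min s t).
  have [st|/ltW ts] := leP s t.
    by apply/minn_idPl; apply: le_truncn; rewrite ler_wpM2l.
  by apply/minn_idPr; apply: le_truncn; rewrite ler_wpM2l.
pose main n := (Num.truncn (n%:R * Num.min s t))%:R / n%:R * kap.
have main_cvg : main n @[n --> \oo] --> Num.min s t * kap.
  apply: cvgM; last exact: cvg_cst.
  by apply: cvg_truncn_div; rewrite le_min s0.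
have err_cvg : D n / n%:R - main n @[n --> \oo] --> (0 : R).
  apply/cvgr0Pnorm_le => e e0; near=> n.
  have n0 : 0 < n%:R :> R by rewrite ltr0n; near: n; exact: nbhs_infty_gt.
  have := ar1_form_upto_dist (sN n) (tN n); rewrite minE -/kap -/(D n) => h.
  rewrite /main mulrAC -mulrBl normrM normfV (@gtr0_norm _ n%:R)// ler_pdivrMr//.
  apply: le_trans h _; rewrite -ler_pdivrMl//.
  near: n; exact: nbhs_infty_ger.
rewrite -[X in _ --> X]add0r.
rewrite [X in X @ _ --> _](_ : _ = (fun n => D n / n%:R - main n) \+ main).
  exact: cvgD.
by apply/funext => n /=; rewrite subrK.
Unshelve. all: by end_near. Qed.

End ArForm.

(** * The moment generating function of Brownian motion *)

Section NormalMgf.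
Context (R : realType) d (T : measurableType d) (P : probability T R).

(** Completing the square turns the exponentially tilted density into
    [expR (s ^+ 2 * u ^+ 2 / 2)] times the density of mean [s ^+ 2 * u]. *)
Lemma normal_mgf (X : T -> R) (s u : R) : measurable_fun setT X -> s != 0 ->
  has_law P X (normal_prob 0 s) ->
  (\int[P]_w (expR (u * X w))%:E = (expR (s ^+ 2 * u ^+ 2 / 2))%:E)%E.
Proof.
move=> mX s0 lX.
have mexp : measurable_fun setT (fun x : R => (expR (u * x))%:E).
  by apply/measurable_EFinP; apply: measurableT_comp => //; exact: mulrl_measurable.
transitivity (\int[P]_w (((cst 1 : T -> R) w)%:E * (expR (u * X w))%:E))%E.
  by apply: eq_integral => w _; rewrite mul1e.
rewrite (@eq_integral_weighted_law R _ _ _ _ _ _ P (@lebesgue_measure R) (cst 1)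
  (normal_pdf 0 s) X id (fun x => (expR (u * x))%:E))//.
- transitivity (\int[@lebesgue_measure R]_x
      ((expR (s ^+ 2 * u ^+ 2 / 2))%:E * (normal_pdf (s ^+ 2 * u) s x)%:E))%E.
    apply: eq_integral => x _; rewrite !normal_pdfE// -!EFinM; congr EFin.
    rewrite /normal_fun -[LHS]mulrA -[in LHS]expRD [RHS]mulrCA -[in RHS]expRD.
    congr (_ * expR _); field.
    by rewrite s0.
  rewrite ge0_integralZl_EFin ?expR_ge0//.
  + by rewrite integral_normal_pdf mule1.
  + by move=> x _; rewrite lee_fin normal_pdf_ge0.
  + by apply/measurable_EFinP; exact: measurable_normal_pdf.
- exact: measurable_normal_pdf.
- by move=> x; exact: normal_pdf_ge0.
move=> B mB.
have mpre : measurable (X @^-1` B) by rewrite -[_ @^-1` _]setTI; exact: mX.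
under eq_integral do rewrite mul1r.
rewrite -[LHS]/(\int[P]_w (\1_(X @^-1` B) w)%:E)%E integral_indic ?setIT// [LHS](lX B)//.
rewrite /normal_prob [LHS]integral_mkcond.
transitivity (\int[@lebesgue_measure R]_w (normal_pdf 0 s w * \1_B w)%:E)%E; last by [].
apply: eq_integral => x _.
by rewrite /patch indicE; case: ifP => _; rewrite ?mulr1 ?mulr0.
Qed.

End NormalMgf.

Section Telescope.
Variables (R : realType) (tau : nat -> R).
Hypothesis tau_homo : {homo tau : i j / (i <= j)%N >-> i <= j}.

(** The times may be repeated: an index [k >= q] with [tau k.+1 <= tau q] also
    satisfies [tau k.+1 = tau k], and its term is 0. The indicator can thus be
    expressed by the times themselves instead of their ranks. *)
Lemma telescope_until (g : R -> R) (q K : nat) : (q <= K)%N ->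
  \sum_(0 <= k < K) (tau k.+1 <= tau q)%R%:R * (g (tau k.+1) - g (tau k)) =
  g (tau q) - g (tau 0%N).
Proof.
move=> qK; rewrite (@big_cat_nat _ _ _ q)//= [X in _ + X]big_nat_cond.
rewrite [X in _ + X]big1 ?addr0; last first.
  move=> k /andP[/andP[qk _] _]; case: (boolP (_ <= _)) => h; last by rewrite mul0r.
  have e : tau k.+1 = tau q.
    by apply/eqP; rewrite eq_le h tau_homo// (leq_trans qk).
  have e' : tau k = tau q.
    apply/eqP; rewrite eq_le -{1}e tau_homo//=; exact: tau_homo.
  by rewrite e e' subrr mulr0.
rewrite -(telescope_sumr (fun k => g (tau k)) (leq0n q)).
apply: eq_big_nat => k /andP[_ kq].
by rewrite tau_homo// mul1r.
Qed.

End Telescope.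

(** The sorted list of the times, preceded by 0 and continued by its last
    element: this is the form of the times in the independence of the
    increments. *)
Lemma enumerate_times (R : realType) m (t : 'I_m -> R) : (forall i, 0 <= t i) ->
  exists tau : nat -> R, exists K : nat, [/\ tau 0%N = 0,
    {homo tau : i j / (i <= j)%N >-> i <= j} &
    forall i, exists2 q, (q <= K)%N & tau q = t i].
Proof.
move=> t0; pose r := sort <=%R (codom t).
pose s := 0 :: r.
have r0 : all (>= 0) r.
  by apply/allP => x; rewrite mem_sort => /codomP[i ->].
have ss : sorted <=%R s.
  rewrite /s /= path_min_sorted//; exact: (sort_sorted le_total).
exists (fun k => nth 0 s (minn k (size r))), (size r); split.
- by rewrite min0n.
- move=> i j ij; apply: (sorted_leq_nth le_trans le_refl) => //.
  + by rewrite inE/= ltnS geq_minr.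
  + by rewrite inE/= ltnS geq_minr.
  + by rewrite leq_min geq_minr andbT geq_min ij.
- move=> i; have : t i \in r by rewrite mem_sort codom_f.
  move/(nthP 0) => [q qr <-]; exists q.+1 => //.
  by rewrite (minn_idPl qr).
Qed.

Section BrownianMgf.
Variables (R : realType) (B : process R).
Hypothesis hB : standard_brownian_motion B.

(** A linear form in the values of [B] at arbitrary times is rewritten as a
    linear form in the increments along the sorted times. [telescope_until] is
    used twice: for the paths of [B], and for the identity, which turns the
    variances of the increments back into minima of times. *)
Lemma brownian_mgf m (t : 'I_m -> R) : (forall i, 0 <= t i) ->
  mgf t B (fun u => expR ((\sum_i \sum_j u 0 i * u 0 j * Num.min (t i) (t j)) / 2)).
Proof.
move=> t0 u; have [B0 Bindep Bnormal _] := hB.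
have [tau [K [tau0 tauh tauq]]] := enumerate_times t0.
have tau_ge0 k : 0 <= tau k by rewrite -tau0; exact: tauh.
have mB k : measurable_fun setT (B (tau k)) by exact: measurable_pval.
pose D k w := B (tau k.+1) w - B (tau k) w.
have mD k : measurable_fun setT (D k) by exact: measurable_funB.
pose c k := \sum_i u 0 i * (tau k.+1 <= t i)%R%:R.
have tele (g : R -> R) i :
    \sum_(0 <= k < K) (tau k.+1 <= t i)%R%:R * (g (tau k.+1) - g (tau k)) = g (t i) - g 0.
  by have [q qK <-] := tauq i; rewrite telescope_until// tau0.
transitivity (\int[pprob B]_w (\prod_(k <- index_iota 0 K) expR (c k * D k w))%:E)%E.
  apply: ge0_ae_eq_integral => //.
  - by apply/measurable_EFinP; apply: measurableT_comp => //; exact: measurable_dotr.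
  - apply/measurable_EFinP; apply: measurable_prod => k _.
    by apply: measurableT_comp => //; exact: measurable_funM.
  - by move=> w _; rewrite lee_fin prodr_ge0// => k _; exact: expR_ge0.
  apply: filterS B0 => w Bw _; congr EFin; rewrite -expR_sum; congr expR.
  rewrite /dotr /c; under [RHS]eq_bigr do rewrite mulr_suml.
  rewrite exchange_big; apply: eq_bigr => i _; rewrite mxE.
  under eq_bigr do rewrite -mulrA.
  by rewrite -mulr_sumr (tele (fun s => B s w)) Bw subr0.
have inc k : (\int[pprob B]_w (expR (c k * D k w))%:E =
    (expR ((tau k.+1 - tau k) * c k ^+ 2 / 2))%:E)%E.
  have := tauh k k.+1 (leqnSn k); rewrite le_eqVlt => /predU1P[e|lt].
    rewrite -e subrr !mul0r expR0 /D -e.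
    under eq_integral do rewrite subrr mulr0 expR0.
    by rewrite integral_cst// mul1e; exact: probability_setT.
  have s0 : Num.sqrt (tau k.+1 - tau k) != 0 by rewrite gt_eqF// sqrtr_gt0 subr_gt0.
  rewrite (normal_mgf (c k) (mD k) s0); last exact: Bnormal.
  by rewrite sqr_sqrtr// subr_ge0 ltW.
rewrite (@indep_integral_prod _ _ _ _ _
  (fun k => g_sigma_algebra_preimage (fun w => B (tau k.+1) w - B (tau k) w)) _ _
  (fun k w => expR (c k * D k w)) (fun k => expR ((tau k.+1 - tau k) * c k ^+ 2 / 2))).
- congr EFin; rewrite -expR_sum -mulr_suml; congr (expR (_ / 2)).
  have cE k : (tau k.+1 - tau k) * c k ^+ 2 = \sum_i \sum_j u 0 i * u 0 j *
      ((tau k.+1 <= Num.min (t i) (t j))%R%:R * (tau k.+1 - tau k)).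
    rewrite expr2 {1}/c mulr_suml mulr_sumr; apply: eq_bigr => i _.
    rewrite /c mulr_sumr mulr_sumr; apply: eq_bigr => j _.
    rewrite le_min; case: (_ <= t i); case: (_ <= t j); rewrite /= ?mulr1 ?mulr0 ?mul0r ?mulr0//.
    by rewrite mul1r mulrC.
  under eq_bigr do rewrite cE.
  rewrite exchange_big; apply: eq_bigr => i _; rewrite exchange_big; apply: eq_bigr => j _.
  rewrite -mulr_sumr; congr (_ * _).
  by have [_|_] := leP (t i) (t j); rewrite (tele id) subr0.
- by move=> k _ [A mA <-]; exact: mD.
- by apply: Bindep; [rewrite tau0|].
- exact: iota_uniq.
- by move=> *; exact: expR_ge0.
- move=> k A _ mA; exists ((fun x => expR (c k * x)) @^-1` A); last by rewrite setTI.
  rewrite -[_ @^-1` A]setTI.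
  have : measurable_fun setT (fun x : R => expR (c k * x)).
    by apply: measurableT_comp => //; exact: mulrl_measurable.
  by apply.
- by move=> k _; exact: inc.
Qed.

End BrownianMgf.

(** * The two iterated limits *)

Lemma fdd_cvg_of_mgf (R : realType) (Y : nat -> process R) (Z : process R) :
  (forall m (t : 'I_m -> R), (forall i, 0 <= t i) ->
    exists L : nat -> 'rV[R]_m -> R, exists LZ : 'rV[R]_m -> R,
    [/\ forall n, mgf t (Y n) (L n), mgf t Z LZ &
        forall u, L n u @[n --> \oo] --> LZ u]) ->
  fdd_cvg Y Z.
Proof.
move=> H m t t0 f cf bf; have [L [LZ [YL ZL LLZ]]] := H m t t0.
exact: (cvg_expect_bounded_continuous t0 YL ZL LLZ).
Qed.

Lemma mgf_scale (R : realType) m (t : 'I_m -> R) (c : R) (Y : process R) L :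
  mgf t Y L -> mgf t (scale_process c Y) (fun u => L (c *: u)).
Proof.
move=> YL u; rewrite -YL; apply: eq_integral => w _; congr (expR _)%:E.
by apply: eq_bigr => i _; rewrite !mxE /=; ring.
Qed.

Section AggregatedMgf.
Context (R : realType) (alpha lambda : R).
Hypotheses (alpha01 : 0 < alpha < 1) (lambda0 : 0 < lambda).
Context (d0 : measure_display) (T0 : measurableType d0) (P0 : probability T0 R).
Context (X0 : {RV P0 >-> nat}) (xi : nat -> nat -> {RV P0 >-> bool})
  (eps : nat -> {RV P0 >-> nat}).
Hypotheses (lX0 : has_law P0 X0 (poisson_prob (lambda / (1 - alpha)) 0%N))
  (lxi : forall k j, has_law P0 (xi k j) (bernoulli_prob alpha))
  (leps : forall k, has_law P0 (eps k) (poisson_prob lambda 0%N))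
  (indep : mutually_independent P0 (innovation_sigma X0 xi eps)).
Context (d : measure_display) (T : measurableType d) (P : probability T R)
  (X : nat -> nat -> {RV P >-> nat})
  (hX : independent_copies P0 (inar X0 xi eps) P X).

Let mu := lambda / (1 - alpha).

Lemma inar_exponent0 n (y : R) : inar_exponent alpha (fun=> 0) n y = 0.
Proof. by elim: n y => //= n IH y; rewrite IH expR0 subrr mul0r addr0. Qed.

Let mY k : measurable_fun setT (inar X0 xi eps k).
Proof. exact: measurable_inar. Qed.

Let mX j k : measurable_fun setT (X j k).
Proof. by []. Qed.

(** The generating function of a single time is the case [v = 0] of
    [inar_pgf]. *)
Lemma copy_mean j k : fine ('E_P[(fun w => (X j k w)%:R : R)])%E = mu.
Proof.
apply: expectation_of_pgf => // z z0.
rewrite (integral_copy mY mX hX j (H := fun x => (z ^+ x k)%:E)).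
- have := inar_pgf alpha01 lambda0 lX0 lxi leps indep (fun=> 0) k z0.
  rewrite inar_exponent0 addr0 => <-; apply: eq_integral => w _.
  by rewrite /path_exp big1 ?mul1r// => i _; rewrite mul0r expR0.
- apply/measurable_EFinP; apply: (@measurableT_comp _ _ _ _ _ _ (fun k : nat => z ^+ k)) => //.
  exact: measurable_coordinate.
- by move=> x; rewrite lee_fin exprn_ge0// ltW.
Qed.

(** The coefficient of the time [k] in the linear form [u] of the partial sums
    at the times [t i]. *)
Definition weights m (u : 'rV[R]_m) (t : 'I_m -> R) (n k : nat) : R :=
  \sum_i u 0 i * upto R (Num.truncn (n%:R * t i)) k.

Lemma weightsE m (u : 'rV[R]_m) (t : 'I_m -> R) n K (G : nat -> R) :
  (forall i, (Num.truncn (n%:R * t i) < K)%N) ->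
  \sum_i u 0 i * \sum_(1 <= k < (Num.truncn (n%:R * t i)).+1) G k =
  \sum_(k < K) weights u t n k * G k.
Proof.
move=> tK; under [RHS]eq_bigr do rewrite mulr_suml.
rewrite exchange_big; apply: eq_bigr => i _.
by rewrite -(sum_upto _ (tK i)) mulr_sumr; apply: eq_bigr => k _; rewrite mulrA.
Qed.

Lemma aggregated_mgf m (t : 'I_m -> R) N n K :
  (forall i, (Num.truncn (n%:R * t i) < K)%N) ->
  mgf t (aggregated_sum X N n) (fun u => expR (N%:R * (mu *
    (inar_exponent alpha (weights u t n) K 0 - \sum_(k < K) weights u t n k)))).
Proof.
move=> tK u; set v := weights u t n.
have inar0 := inar_mgf alpha01 lambda0 lX0 lxi leps indep v K.
have XN := copies_mgf mY mX hX N inar0.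
transitivity (\int[P]_w ((expR (- (N%:R * (mu * \sum_(k < K) v k))))%:E *
    (expR (\sum_(j < N) \sum_(k < K) v k * (X j k w)%:R))%:E))%E.
  apply: eq_integral => w _; rewrite -EFinM -expRD; congr (expR _)%:E.
  rewrite /dotr; under eq_bigr do rewrite mxE /=.
  transitivity (\sum_i u 0 i * \sum_(1 <= k < (Num.truncn (n%:R * t i)).+1)
      (\sum_(j < N) (X j k w)%:R - N%:R * mu)).
    apply: eq_bigr => i _; congr (_ * _); rewrite exchange_big; apply: eq_bigr => k _.
    rewrite sumrB; congr (_ - _).
    under eq_bigr do rewrite copy_mean.
    by rewrite sumr_const card_ord mulr_natl.
  rewrite (weightsE _ _ tK) -/v; under eq_bigr do rewrite mulrBr.
  rewrite sumrB addrC; congr (_ + _).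
    by congr (- _); rewrite -mulr_suml mulrC mulrA.
  rewrite exchange_big; apply: eq_bigr => k _.
  by rewrite mulr_sumr.
rewrite ge0_integralZl_EFin ?expR_ge0//; last first.
  apply/measurable_EFinP; apply: measurableT_comp => //.
  apply: measurable_sum => j; apply: measurable_sum => k; apply: measurable_funM => //.
  by apply: (@measurableT_comp _ _ _ _ _ _ (fun k : nat => k%:R : R)).
rewrite XN -EFinM -expRM_natl -expRD; congr (expR _)%:E.
by rewrite /mu; ring.
Qed.

End AggregatedMgf.

Lemma cvg_inv_sqrt (R : realType) (N : nat) : (0 < N)%N ->
  (Num.sqrt (n%:R * N%:R))^-1 @[n --> \oo] --> (0 : R).
Proof.
move=> N0; apply/cvgr0Pnorm_le => e e0; near=> n.
have n0 : 0 < n%:R :> R by rewrite ltr0n; near: n; exact: nbhs_infty_gt.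
have NR0 : 1 <= N%:R :> R by rewrite ler1n.
have s0 : 0 < Num.sqrt (n%:R * N%:R : R).
  by rewrite sqrtr_gt0 mulr_gt0// (lt_le_trans ltr01).
rewrite ger0_norm ?invr_ge0 ?(ltW s0)// -[leRHS]invrK lef_pV2 ?posrE ?invr_gt0//.
have -> : e^-1 = Num.sqrt (e ^- 2) by rewrite -exprVn sqrtr_sqr ger0_norm// invr_ge0 ltW.
rewrite ler_wsqrtr// (@le_trans _ _ n%:R)//; last by rewrite ler_peMr// ltW.
near: n; exact: nbhs_infty_ger.
Unshelve. all: by end_near. Qed.

Section ExponentLimits.
Context (R : realType) (alpha lambda : R) (m : nat) (t : 'I_m -> R).
Hypotheses (alpha01 : 0 < alpha < 1) (lambda0 : 0 < lambda) (t0 : forall i, 0 <= t i).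

Let mu := lambda / (1 - alpha).
Let kap := (1 + alpha) / (1 - alpha).

Definition horizon (n : nat) : nat := (Num.truncn (n%:R * \sum_i t i)).+1.

Lemma ltn_horizon n i : (Num.truncn (n%:R * t i) < horizon n)%N.
Proof.
rewrite ltnS le_truncn// ler_wpM2l// (bigD1 i)//= lerDl.
by apply: sumr_ge0 => j _; exact: t0.
Qed.

Definition scaling (N n : nat) : R := (Num.sqrt (n%:R * N%:R))^-1.

(** The exponent of [aggregated_mgf], with [horizon n] as the number of
    times. *)
Definition log_mgf N n (u : 'rV[R]_m) : R :=
  N%:R * (mu * (inar_exponent alpha (weights u t n) (horizon n) 0 -
    \sum_(k < horizon n) weights u t n k)).

(** Half the variance of the linear form [u] of the Gaussian process obtained as
    [N] tends to infinity. *)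
Definition half_variance n (u : 'rV[R]_m) : R :=
  mu / 2 * \sum_i \sum_j u 0 i * u 0 j *
    (ar1_form alpha (horizon n) (upto R (Num.truncn (n%:R * t i)))
       (upto R (Num.truncn (n%:R * t j))) / n%:R).

(** The estimate behind both limits, uniform in [N] and [n]. There are [N]
    copies and [O(n)] times, each contributing an error of order
    [(n * N) ^ (-3 / 2)]; the total error has the order of the scaling, and it
    vanishes as soon as one of [N] and [n] tends to infinity. The quadratic
    part does not depend on [N]. *)
Lemma log_mgf_dist u : exists C : R, exists2 e : R, 0 < e &
  forall N n, (0 < N)%N -> (0 < n)%N -> scaling N n <= e ->
  `|log_mgf N n (scaling N n *: u) - half_variance n u| <= C * scaling N n.
Proof.
have /andP[a0 a1] := alpha01.
have a'0 : 0 < 1 - alpha by rewrite subr_gt0.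
have mu0 : 0 < mu by rewrite divr_gt0.
pose U := \sum_i `|u 0 i| + 1; have U0 : 0 < U by rewrite ltr_wpDl// sumr_ge0.
pose K := 8 / (1 - alpha); pose K' := (4 + 4 * K) / (1 - alpha).
have K0 : 0 < K by rewrite divr_gt0.
have K'0 : 0 < K' by rewrite divr_gt0// addr_gt0// mulr_gt0.
pose C1 := 4 + 4 * K + K'; have C10 : 0 < C1 by rewrite !addr_gt0// mulr_gt0.
pose S := \sum_i t i; have S0 : 0 <= S by apply: sumr_ge0 => i _; exact: t0.
exists (mu * (C1 * U ^+ 3) * (S + 1)), ((1 - alpha) / 8 / U); first by rewrite !divr_gt0.
move=> N n N0 n0; set c := scaling N n => ce.
have NR0 : 0 < N%:R :> R by rewrite ltr0n.
have nR0 : 0 < n%:R :> R by rewrite ltr0n.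
have c0 : 0 < c by rewrite invr_gt0 sqrtr_gt0 mulr_gt0.
have c2 : c ^+ 2 = (n%:R * N%:R)^-1 by rewrite exprVn sqr_sqrtr// mulr_ge0 ?ltW.
pose v := weights (c *: u) t n.
have vb k : `|v k| <= c * U.
  rewrite /v /weights (le_trans (ler_norm_sum _ _ _))//.
  rewrite (@le_trans _ _ (\sum_i c * `|u 0 i|))//; last first.
    by rewrite -mulr_sumr ler_pM2l// lerDl.
  apply: ler_sum => i _; rewrite mxE !normrM gtr0_norm// ler_piMr ?mulr_ge0 ?(ltW c0)//.
  by rewrite /upto normr_nat; case: (_ && _).
have cU0 : 0 < c * U by rewrite mulr_gt0.
have cU : c * U <= (1 - alpha) / 8 by rewrite -ler_pdivlMr.
have := @inar_exponent_dist R alpha alpha01 v (c * U) (horizon n) cU0 cU vb 0 0.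
rewrite subr0 normr0 -/K -/K' -/C1 => /(_ _ _) H.
have {}H : `|inar_exponent alpha v (horizon n) 0 - quadratic_exponent alpha v (horizon n) 0| <=
    (horizon n)%:R * (C1 * (c * U) ^+ 3).
  apply: H; first by rewrite mulr_ge0 ?(ltW K0) ?(ltW cU0).
  by rewrite mulr_ge0 ?exprn_ge0 ?(ltW K'0) ?(ltW cU0).
have QE : N%:R * (mu * (ar1_form alpha (horizon n) v v / 2)) = half_variance n u.
  rewrite /half_variance /v ar1_form_sum.
  have -> : \sum_i \sum_j (c *: u) 0 i * (c *: u) 0 j *
      ar1_form alpha (horizon n) (upto R (Num.truncn (n%:R * t i))) (upto R (Num.truncn (n%:R * t j))) =
      N%:R^-1 * \sum_i \sum_j u 0 i * u 0 j * (ar1_form alpha (horizon n)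
        (upto R (Num.truncn (n%:R * t i))) (upto R (Num.truncn (n%:R * t j))) / n%:R).
    rewrite mulr_sumr; apply: eq_bigr => i _; rewrite mulr_sumr; apply: eq_bigr => j _.
    rewrite !mxE; set F := ar1_form _ _ _ _.
    have -> : c * u 0 i * (c * u 0 j) * F = c ^+ 2 * (u 0 i * u 0 j * F) by ring.
    rewrite c2; field; by rewrite !gt_eqF.
  set F := \sum_i _; field; by rewrite gt_eqF.
have -> : log_mgf N n (c *: u) - half_variance n u = N%:R * (mu *
    (inar_exponent alpha v (horizon n) 0 - quadratic_exponent alpha v (horizon n) 0)).
  rewrite -QE quadratic_exponentE [X in _ + _ + X]big1; last by move=> k _; rewrite mulr0.
  by rewrite /log_mgf -/v; ring.
rewrite (normrM N%:R) (gtr0_norm NR0) (normrM mu) (gtr0_norm mu0).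
apply: (@le_trans _ _ (N%:R * (mu * ((horizon n)%:R * (C1 * (c * U) ^+ 3))))).
  by rewrite !ler_pM2l.
have hn : (horizon n)%:R <= n%:R * (S + 1) :> R.
  rewrite -natr1 mulrDr mulr1 lerD ?ler1n//.
  have /truncn_itv/andP[//] : 0 <= n%:R * S by rewrite mulr_ge0.
have -> : N%:R * (mu * ((horizon n)%:R * (C1 * (c * U) ^+ 3))) =
    (mu * (C1 * U ^+ 3) * c) * (N%:R * c ^+ 2 * (horizon n)%:R) by ring.
have -> : mu * (C1 * U ^+ 3) * (S + 1) * c = (mu * (C1 * U ^+ 3) * c) * (S + 1) by ring.
rewrite ler_wpM2l//.
  exact: (mulr_ge0 (mulr_ge0 (ltW mu0) (mulr_ge0 (ltW C10) (exprn_ge0 3 (ltW U0)))) (ltW c0)).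
rewrite c2; have -> : N%:R * (n%:R * N%:R)^-1 = n%:R^-1 :> R by field; rewrite !gt_eqF.
by rewrite ler_pdivrMl.
Qed.

Lemma cvg_half_variance u : half_variance n u @[n --> \oo] -->
  mu * kap / 2 * \sum_i \sum_j u 0 i * u 0 j * Num.min (t i) (t j).
Proof.
have -> : mu * kap / 2 * \sum_i \sum_j u 0 i * u 0 j * Num.min (t i) (t j) =
    mu / 2 * \sum_i \sum_j u 0 i * u 0 j * (Num.min (t i) (t j) * kap).
  have E (S : R) : mu * kap / 2 * S = mu / 2 * (S * kap) by ring.
  rewrite E; congr (_ * _).
  rewrite mulr_suml; apply: eq_bigr => i _; rewrite mulr_suml; apply: eq_bigr => j _.
  by rewrite -[LHS]mulrA.
apply: cvgM; first exact: cvg_cst.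
apply: cvg_big => [|i _]; first exact: add_continuous.
apply: cvg_big => [|j _]; first exact: add_continuous.
apply: cvgM; first exact: cvg_cst.
by apply: cvg_ar1_form_upto => //; move=> n; exact: ltn_horizon.
Qed.

Lemma cvg_log_mgf_time N u : (0 < N)%N ->
  log_mgf N n (scaling N n *: u) @[n --> \oo] -->
  mu * kap / 2 * \sum_i \sum_j u 0 i * u 0 j * Num.min (t i) (t j).
Proof.
move=> N0; have [C [e e0 H]] := log_mgf_dist u.
have sc := @cvg_inv_sqrt R N N0.
have err : log_mgf N n (scaling N n *: u) - half_variance n u @[n --> \oo] --> (0 : R).
  apply: norm_cvg0; apply: (@squeeze_cvgr _ _ _ _ (fun=> 0) (fun n => C * scaling N n)).
  - near=> n; rewrite normr_ge0 H//; first by near: n; exact: nbhs_infty_gt.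
    near: n; apply: (cvgr_le 0) => //.
  - exact: cvg_cst.
  - by rewrite -[X in _ --> X](mulr0 C); apply: cvgM => //; exact: cvg_cst.
rewrite -[X in _ --> X]add0r.
rewrite [X in X @ _ --> _](_ : _ =
  (fun n => log_mgf N n (scaling N n *: u) - half_variance n u) \+ half_variance ^~ u).
  by apply: cvgD => //; exact: cvg_half_variance.
by apply/funext => n /=; rewrite subrK.
Unshelve. all: by end_near. Qed.

Lemma cvg_log_mgf_copies n u : (0 < n)%N ->
  log_mgf N n (scaling N n *: u) @[N --> \oo] --> half_variance n u.
Proof.
move=> n0; have [C [e e0 H]] := log_mgf_dist u.
have sc : scaling N n @[N --> \oo] --> (0 : R).
  by rewrite /scaling; under eq_fun do rewrite mulrC; exact: cvg_inv_sqrt.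
apply/subr_cvg0; apply: norm_cvg0.
apply: (@squeeze_cvgr _ _ _ _ (fun=> 0) (fun N => C * scaling N n)).
- near=> N; rewrite normr_ge0 H//; first by near: N; exact: nbhs_infty_gt.
  near: N; apply: (cvgr_le 0) => //.
- exact: cvg_cst.
- by rewrite -[X in _ --> X](mulr0 C); apply: cvgM => //; exact: cvg_cst.
Unshelve. all: by end_near. Qed.

End ExponentLimits.

(** The intermediate limit for fixed [n] is a sum of a stationary Gaussian
    autoregression with covariances [s2 * alpha ^+ `|k - l|]. It is realized on
    the probability space of [B] as a time-changed Brownian motion, in the same
    way as the Ornstein-Uhlenbeck process:
    [Num.sqrt s2 * alpha ^+ k * B (alpha ^- (2 * k))]. *)

Section GaussianAutoregression.
Context (R : realType) (alpha s2 : R) (B : process R).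
Hypotheses (alpha01 : 0 < alpha < 1) (s20 : 0 <= s2).
Hypothesis hB : standard_brownian_motion B.

Definition ou_time (k : nat) : R := alpha ^- (k + k).

Lemma ou_time_ge0 k : 0 <= ou_time k.
Proof. by have /andP[a0 _] := alpha01; rewrite invr_ge0 exprn_ge0// ltW. Qed.

Lemma measurable_ou_sum n (r : R) : measurable_fun setT (fun w =>
  \sum_(1 <= k < (Num.truncn (n%:R * r)).+1)
    Num.sqrt s2 * alpha ^+ k * B (ou_time k) w).
Proof.
apply: measurable_sum => k; apply: measurable_funM => //.
exact/measurable_pval/ou_time_ge0.
Qed.

Definition ou_sum (n : nat) : process R :=
  @Process R _ (pspace B) (pprob B) _ (fun r _ => @measurable_ou_sum n r).

Lemma ou_covariance k l :
  alpha ^+ k * alpha ^+ l * Num.min (ou_time k) (ou_time l) =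
  alpha ^+ (k - l + (l - k))%N.
Proof.
have /andP[a0 a1] := alpha01.
wlog kl : k l / (k <= l)%N => [H|].
  have [kl|/ltnW lk] := leqP k l; first exact: H.
  by rewrite addnC minC [alpha ^+ k * _]mulrC H.
have -> : Num.min (ou_time k) (ou_time l) = ou_time k.
  apply/min_idPl; rewrite /ou_time lef_pV2 ?posrE ?exprn_gt0//.
  by rewrite ler_wiXn2l ?(ltW a0) ?(ltW a1)// leq_add.
have /eqP -> : (k - l == 0)%N by rewrite subn_eq0.
rewrite /ou_time add0n -{1}(subnK kl) !exprD.
by field; rewrite !expf_neq0 ?gt_eqF.
Qed.

Lemma ou_mgf m (t : 'I_m -> R) n K :
  (forall i, (Num.truncn (n%:R * t i) < K)%N) ->
  mgf t (ou_sum n) (fun u =>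
    expR (s2 * ar1_form alpha K (weights u t n) (weights u t n) / 2)).
Proof.
move=> tK u; pose v := weights u t n.
pose u' : 'rV[R]_K := \row_k (v k * (Num.sqrt s2 * alpha ^+ k)).
have := brownian_mgf hB (fun k : 'I_K => ou_time_ge0 k) u'.
have -> : \sum_i \sum_j u' 0 i * u' 0 j * Num.min (ou_time i) (ou_time j) =
    s2 * ar1_form alpha K v v.
  rewrite /ar1_form mulr_sumr; apply: eq_bigr => k _.
  rewrite mulr_sumr; apply: eq_bigr => l _; rewrite !mxE -ou_covariance.
  rewrite -[in RHS](sqr_sqrtr s20); set q := Num.sqrt s2; ring.
move=> <-; apply: eq_integral => w _; congr (expR _)%:E.
rewrite /dotr; under eq_bigr do rewrite mxE/=.
rewrite (weightsE _ _ tK); apply: eq_bigr => k _.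
by rewrite !mxE; rewrite !mulrA.
Qed.

End GaussianAutoregression.

(* The second argument of poisson_prob is a dummy. *)
Theorem theorem3p3 (R : realType) (alpha lambda : R)
  (halpha : 0 < alpha < 1) (hlambda : 0 < lambda)
  (d0 : measure_display) (T0 : measurableType d0) (P0 : probability T0 R)
  (X0 : {RV P0 >-> nat}) (xi : nat -> nat -> {RV P0 >-> bool})
  (eps : nat -> {RV P0 >-> nat})
  (hX0 : has_law P0 X0 (poisson_prob (lambda / (1 - alpha)) 0%N))
  (hxi : forall k j, has_law P0 (xi k j) (bernoulli_prob alpha))
  (heps : forall k, has_law P0 (eps k) (poisson_prob lambda 0%N))
  (hindep : mutually_independent P0 (innovation_sigma X0 xi eps))
  (d : measure_display) (T : measurableType d) (P : probability T R)
  (X : nat -> nat -> {RV P >-> nat})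
  (hX : independent_copies P0 (inar X0 xi eps) P X)
  (B : process R) (hB : standard_brownian_motion B) :
  let S N n := scale_process (Num.sqrt (n%:R * N%:R))^-1 (aggregated_sum X N n) in
  let L := scale_process (Num.sqrt (lambda * (1 + alpha)) / (1 - alpha)) B in
  iterated_fdd_lim (fun N n => S N n) L /\
  iterated_fdd_lim (fun n N => S N n) L.
Proof.
move=> S L; have /andP[a0 a1] := halpha.
have a'0 : 0 < 1 - alpha by rewrite subr_gt0.
pose mu := lambda / (1 - alpha); have mu0 : 0 < mu by rewrite divr_gt0.
pose kap := (1 + alpha) / (1 - alpha).
have expR_cvg (f : nat -> R) (l : R) : f n @[n --> \oo] --> l ->
    expR (f n) @[n --> \oo] --> expR l.
  by move=> fl; apply: continuous_cvg => //; exact: continuous_expR.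
have S_mgf m (t : 'I_m -> R) (t0 : forall i, 0 <= t i) N n :
    mgf t (S N n) (fun u => expR (log_mgf alpha lambda t N n (scaling R N n *: u))).
  have h := aggregated_mgf halpha hlambda hX0 hxi heps hindep hX N (@ltn_horizon R m t t0 n).
  exact (@mgf_scale R m t (scaling R N n) _ _ h).
have L_mgf m (t : 'I_m -> R) (t0 : forall i, 0 <= t i) :
    mgf t L (fun u => expR (mu * kap / 2 *
      \sum_i \sum_j u 0 i * u 0 j * Num.min (t i) (t j))).
  pose c := Num.sqrt (lambda * (1 + alpha)) / (1 - alpha).
  move=> u; transitivity (expR ((\sum_i \sum_j (c *: u) 0 i * (c *: u) 0 j *
      Num.min (t i) (t j)) / 2))%:E.
    exact (@mgf_scale R m t c B _ (brownian_mgf hB t0) u).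
  congr (expR _)%:E.
  have c2 : c ^+ 2 = mu * kap.
    rewrite /c exprMn sqr_sqrtr ?mulr_ge0 ?(ltW hlambda) ?addr_ge0 ?(ltW a0)//.
    by rewrite /mu /kap; field; rewrite gt_eqF.
  rewrite mulrAC -c2; congr (_ / 2); rewrite mulr_sumr; apply: eq_bigr => i _.
  by rewrite mulr_sumr; apply: eq_bigr => j _; rewrite !mxE; ring.
split.
  (* The limit for fixed N does not depend on N. *)
  exists (fun=> L); split=> [N N0|].
    apply: fdd_cvg_of_mgf => m t t0; eexists; eexists; split.
    - by move=> n; exact: S_mgf.
    - exact: L_mgf.
    - by move=> u; apply: expR_cvg; exact: cvg_log_mgf_time.
  by move=> m t t0 f cf bf; exact: cvg_cst.
pose G n := scale_process (Num.sqrt (n%:R : R))^-1 (@ou_sum R alpha mu B halpha n).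
have G_mgf m (t : 'I_m -> R) (t0 : forall i, 0 <= t i) n :
    mgf t (G n) (fun u => expR (half_variance alpha lambda t n u)).
  have h := ou_mgf halpha (ltW mu0) hB (@ltn_horizon R m t t0 n).
  pose c : R := (Num.sqrt (n%:R : R))^-1.
  move=> u; transitivity (expR (mu * ar1_form alpha (horizon t n)
      (weights (c *: u) t n) (weights (c *: u) t n) / 2))%:E.
    exact (@mgf_scale R m t c _ _ h u).
  congr (expR _)%:E; rewrite /half_variance -/mu /weights ar1_form_sum mulrAC.
  congr (_ * _); apply: eq_bigr => i _; apply: eq_bigr => j _.
  rewrite !mxE; set F := ar1_form _ _ _ _.
  have c2 : c ^+ 2 = n%:R^-1 by rewrite exprVn sqr_sqrtr.
  by rewrite -c2; ring.
exists G; split=> [n n0|].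
  apply: fdd_cvg_of_mgf => m t t0; eexists; eexists; split.
  - by move=> N; exact: S_mgf.
  - exact: G_mgf.
  - by move=> u; apply: expR_cvg; exact: cvg_log_mgf_copies.
apply: fdd_cvg_of_mgf => m t t0; eexists; eexists; split.
- by move=> n; exact: G_mgf.
- exact: L_mgf.
- by move=> u; apply: expR_cvg; exact: cvg_half_variance.
Qed.
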